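(* Let $C\subset\mathbb{P}^2$ be a reduced plane curve over $\mathbb{C}$ of degree $n>0$, with equation $F=0$, $F\in\mathbb{C}[x_0,x_1,x_2]_n$, and let $P$ be a point with $F(P)=0$. Run the double point algorithm described in the context on the input $(F,P)$. Then for every integer $r\ge 1$: - the algorithm stops at Step $r$-a if and only if $P$ is an $A_{2r-1}$ singularity of $C$; - the algorithm stops at Step $r$-b if and only if $P$ is an $A_{2r}$ singularity of $C$.
   Context: The ground field is $\mathbb{C}$. A singularity of type $A_s$ of a plane curve ($s\ge 1$) is a double point (point of multiplicity exactly $2$) which, writing $s=2r-\varepsilon$ with $\varepsilon\in\{0,1\}$, can be resolved via $r$ blow-ups and whose desingularization yields two points over it if $\varepsilon=1$ and only one if $\varepsilon=0$ (equivalently, the curve at the point is analytically isomorphic to $y^2-x^{s+1}=0$ at the origin). $i(C,D,P)$ denotes the intersection multiplicity of $C$ and $D$ at $P$ (possibly $\infty$ if they share a component through $P$). **The double point algorithm.** Input: $F$ and $P$ with $F(P)=0$. Step 0. Perform a linear change of coordinates so that $P=[0,0,1]$, and work in the affine chart $\{x_2\ne0\}$ with coordinates $x=x_0/x_2$, $y=x_1/x_2$, in which $C$ has equation $f(x,y)=\sum a_{ij}x^iy^j=0$ with $a_{00}=0$. If $(a_{01},a_{10})\ne(0,0)$, stop ($P$ is a simple point). If $(a_{01},a_{10})=(0,0)$ and $(a_{20},a_{11},a_{02})=(0,0,0)$, stop ($P$ has multiplicity $\ge3$). If $(a_{01},a_{10})=(0,0)$ and $(a_{20},a_{11},a_{02})\ne(0,0,0)$,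 then $P$ is a double point; go to Step 1. Notation: for $\Lambda=(\lambda_1,\dots,\lambda_t)\in\mathbb{C}^t$ let $\Gamma^t_\Lambda$ be the curve $y=\lambda_1x+\lambda_2x^2+\dots+\lambda_tx^t$ and let $R(C,\Gamma^t_\Lambda):=f(x,\lambda_1x+\dots+\lambda_tx^t)\in\mathbb{C}[x]$, so that $i(C,\Gamma^t_\Lambda,P)$ is the least degree of $x$ appearing in $R(C,\Gamma^t_\Lambda)$ (and is $\infty$ if $R(C,\Gamma^t_\Lambda)=0$). Step 1. Perform a linear change of coordinates so that $a_{02}\ne0$. With $\Lambda=(\lambda_1)$, $R(C,\Gamma^1_\Lambda)=(a_{20}+a_{11}\lambda_1+a_{02}\lambda_1^2)x^2+\cdots$. Step 1-a. If $a_{11}^2-4a_{20}a_{02}\ne0$ (so there are two distinct values $\lambda_{11}\neq\lambda_{12}$ of $\lambda_1$ with $i(C,\Gamma^1_{(\lambda_{1j})},P)\ge3$), declare $P$ to be of type $A_1$ and stop. Step 1-b. If $a_{11}^2-4a_{20}a_{02}=0$, there is a unique value $\bar\lambda_1$ with $i(C,\Gamma^1_{(\bar\lambda_1)},P)\ge3$. If $i(C,\Gamma^1_{(\bar\lambda_1)},P)=3$, declare $P$ to be of type $A_2$ and stop. If $i(C,\Gamma^1_{(\bar\lambda_1)},P)\ge4$, go to Step 2. Step $r$ (for $r\ge2$). Let $\bar\lambda_1,\dots,\bar\lambda_{r-1}$ be the values found in Steps 1-b, …, $(r-1)$-b, and let $\Lambda=(\bar\lambda_1,\dots,\bar\lambda_{r-1},\lambda_r)$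 with $\lambda_r$ an unknown. One has $i(C,\Gamma^r_\Lambda,P)\ge2r$, and setting the coefficient of $x^{2r}$ in $R(C,\Gamma^r_\Lambda)$ equal to zero gives a second degree equation in $\lambda_r$; let $\Delta^{2r}_r$ be its discriminant. Step $r$-a. If $\Delta^{2r}_r\ne0$, there are two distinct values $\lambda_{r1}\ne\lambda_{r2}$ such that, for $\Lambda j=(\bar\lambda_1,\dots,\bar\lambda_{r-1},\lambda_{rj})$, $i(C,\Gamma^r_{\Lambda j},P)\ge2r+1$ ($j=1,2$); declare $P$ to be of type $A_{2r-1}$ and stop. Step $r$-b. If $\Delta^{2r}_r=0$, there is a unique $\bar\lambda_r$ such that, for $\bar\Lambda=(\bar\lambda_1,\dots,\bar\lambda_r)$, $i(C,\Gamma^r_{\bar\Lambda},P)\ge2r+1$. If $i(C,\Gamma^r_{\bar\Lambda},P)=2r+1$, declare $P$ to be of type $A_{2r}$ and stop. If $i(C,\Gamma^r_{\bar\Lambda},P)\ge2r+2$, go to Step $r+1$. *)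

(* Defs.v *)
From mathcomp Require Import all_boot all_order all_algebra.
From mathcomp Require Import reals.
From mathcomp Require Import complex.
From mathcomp Require Import mpoly.

Set Implicit Arguments.
Unset Strict Implicit.
Unset Printing Implicit Defensive.

Import GRing.Theory.
Local Open Scope ring_scope.

(* Points of P^2 are given by a nonzero row vector of homogeneous coordinates.
   An affine plane curve f(x, y) = \sum a_ij x^i y^j is an element of
   {poly {poly K}} whose outer indeterminate is y and whose inner
   indeterminate is x, so that a_ij = f`_j`_i. *)

Section Definitions.
Variable K : fieldType.
Implicit Types (F G H : {mpoly K[3]}) (P : 'rV[K]_3) (M N : 'M[K]_3).
Implicit Types (f : {poly {poly K}}) (L : seq K).

Definition on_curve F P : Prop := F.@[P 0] = 0.

Definition reduced F : Prop :=
  F != 0 /\ forall G H, F = G ^+ 2 * H -> exists c : K, G = c%:MP.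

(* (change_coords M F)(v) = F(v M): the equation of the curve in the
   coordinates v in which the old coordinates are v M. *)
Definition change_coords M F : {mpoly K[3]} :=
  F \mPo [tuple \sum_j M j i *: 'X_j | i < 3].

Definition origin : 'rV[K]_3 := delta_mx 0 ord_max.

(* M is invertible and, in the new coordinates, P becomes [0,0,1]. *)
Definition moves_to_origin P M : Prop :=
  M \in unitmx /\ exists c : K, origin *m M = c *: P.

(* The affine equation f(x, y) = F(x, y, 1). *)
Definition dehomog F : {poly {poly K}} :=
  mmap (polyC \o polyC) (fun i : 'I_3 => [:: 'X%:P; 'X; 1]`_i) F.

Definition acoef f (i j : nat) : K := f`_j`_i.

Definition has_mult f (m : nat) : Prop :=
  (forall i j, (i + j < m)%N -> acoef f i j = 0) /\
  (exists i j, (i + j = m)%N /\ acoef f i j != 0).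

(* Blow-up of the origin.  A point of the exceptional divisor is a tangent
   direction: Some l is the line y = l x, and None is the line x = 0.  In the
   affine coordinates centred at that point the total transform of f is
   f(x, x (y + l)), resp. f(x y, y) with the two coordinates exchanged (so that
   the exceptional divisor is always "inner indeterminate = 0"); the strict
   transform is obtained by dividing by the m-th power of that indeterminate,
   m being the multiplicity of f at the origin. *)
Definition total_transform f (d : option K) : {poly {poly K}} :=
  match d with
  | Some l => f \Po ('X%:P * ('X + l%:P%:P))
  | None => swapXY f \Po ('X%:P * 'X)
  end.

Definition strict_transform (m : nat) f (d : option K) : {poly {poly K}} :=
  map_poly (drop_poly m) (total_transform f d).

(* resolution f r k: the germ of f = 0 at the origin is desingularized by
   exactly r blow-ups, each one centred at a singular point, and the
   desingularization has exactly k points over the origin.  In res_blowup, s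
   lists the points of the strict transform that lie over the origin. *)
Inductive resolution f : nat -> nat -> Prop :=
| res_smooth : has_mult f 1 -> resolution f 0 1
| res_blowup (m : nat) (s : seq (option K)) (r k : option K -> nat) :
    (2 <= m)%N -> has_mult f m ->
    uniq s ->
    (forall d, (d \in s) = (acoef (strict_transform m f d) 0 0 == 0)) ->
    (forall d, d \in s -> resolution (strict_transform m f d) (r d) (k d)) ->
    resolution f (\sum_(d <- s) r d).+1 (\sum_(d <- s) k d).

(* The origin is a singularity of type A_s, s = 2 r - e, of f = 0. *)
Definition affine_type_A (s : nat) f : Prop :=
  has_mult f 2 /\
  exists (r : nat) (e : bool), (s + e = 2 * r)%N /\ resolution f r (1 + e).

Definition is_type_A (s : nat) F P : Prop :=
  exists M, moves_to_origin P M /\ affine_type_A s (dehomog (change_coords M F)).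

(* The polynomial l_1 x + l_2 x^2 + ... + l_t x^t, for L = [:: l_1; ...; l_t]. *)
Definition branch (R : nzRingType) (L : seq R) : {poly R} := 'X * Poly L.

(* R(C, Gamma_L) *)
Definition restr f L : {poly K} := f.[branch L].

(* i(C, Gamma_L, P) >= k, resp. = k; the first one holds for all k if
   R(C, Gamma_L) = 0. *)
Definition contact_ge f L (k : nat) : Prop :=
  forall i, (i < k)%N -> (restr f L)`_i = 0.
Definition contact_eq f L (k : nat) : Prop :=
  contact_ge f L k /\ (restr f L)`_k != 0.

(* With L = [:: l_1; ...; l_(r-1)] and r = (size L).+1, the coefficient of
   x^(2r) in R(C, Gamma_(l_1, ..., l_(r-1), l_r)), as a polynomial in the
   unknown l_r. *)
Definition step_poly f L : {poly K} :=
  ((map_poly (map_poly polyC) f).[branch (rcons (map polyC L) 'X)])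
    `_(2 * (size L).+1).

Definition discr2 (q : {poly K}) : K := q`_1 ^+ 2 - 4%:R * q`_0 * q`_2.

Variant outcome :=
| StopSimple
| StopMult3
| StopA of nat   (* stop at Step r-a *)
| StopB of nat.  (* stop at Step r-b *)

(* The algorithm from Step r on, r = (size L).+1, the values found in the
   previous steps being L. *)
Inductive run_step f L : outcome -> Prop :=
| step_a :
    discr2 (step_poly f L) != 0 -> run_step f L (StopA (size L).+1)
| step_b l :
    discr2 (step_poly f L) = 0 ->
    contact_eq f (rcons L l) (2 * (size L).+1 + 1) ->
    run_step f L (StopB (size L).+1)
| step_next l o :
    discr2 (step_poly f L) = 0 ->
    contact_ge f (rcons L l) (2 * (size L).+1 + 2) ->
    run_step f (rcons L l) o ->
    run_step f L o.

Definition simple_test f : bool :=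
  (acoef f 0 1, acoef f 1 0) != (0, 0).
Definition double_test f : bool :=
  ((acoef f 0 1, acoef f 1 0) == (0, 0)) &&
  ((acoef f 2 0, acoef f 1 1, acoef f 0 2) != (0, 0, 0)).
Definition mult3_test f : bool :=
  ((acoef f 0 1, acoef f 1 0) == (0, 0)) &&
  ((acoef f 2 0, acoef f 1 1, acoef f 0 2) == (0, 0, 0)).

(* The algorithm on F, with the coordinate changes M in Step 0 and N in
   Step 1. *)
Inductive run F M N : outcome -> Prop :=
| run_simple :
    simple_test (dehomog (change_coords M F)) -> run F M N StopSimple
| run_mult3 :
    mult3_test (dehomog (change_coords M F)) -> run F M N StopMult3
| run_double o :
    double_test (dehomog (change_coords M F)) ->
    run_step (dehomog (change_coords N (change_coords M F))) [::] o ->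
    run F M N o.

(* The choices of coordinates that the algorithm may make on the input (F, P).
   N only matters when Step 1 is reached; it keeps the point at [0,0,1]. *)
Definition admissible F P M N : Prop :=
  moves_to_origin P M /\
  (double_test (dehomog (change_coords M F)) ->
   moves_to_origin origin N /\
   acoef (dehomog (change_coords N (change_coords M F))) 0 2 != 0).

End Definitions.

(* Main.v *)
Require Import Defs.
From mathcomp Require Import all_boot all_order all_algebra.
From mathcomp Require Import reals.
From mathcomp Require Import complex.
From mathcomp Require Import mpoly.
From mathcomp Require Import ring zify.

(** The proof compares three descriptions of a double point f = 0 at the
    origin of an affine chart in which a02 != 0: the stopping step of the
    algorithm, the tree of blow-ups in [resolution], and an osculation
    property that makes sense in every chart.

    Osculation.  Say that f has osculation of order m, [osculates f m], if a
    smooth curve y = phi(x) through the origin satisfies f(x, phi) = 0 modulo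
    x^m and f_y(x, phi) = 0 modulo x^(m/2), the exponent m/2 being rounded up.
    On y^2 = x^(s+1) this asks for phi^2 = x^(s+1) modulo x^m and phi = 0
    modulo x^(m/2), which is possible exactly when m <= s + 1.  So A_s is
    characterized by osculation of order s + 1 and not of order s + 2.

    One blow-up.  If f has multiplicity 2 and g is its strict transform along
    the direction y = l x, then f(x, x (psi + l)) = x^2 g(x, psi), and
    f_y(x, x (psi + l)) = x g_y(x, psi).  Hence osculation of order m + 2
    of f is osculation of order m of g for some l ([osculates_blowup]), and the
    algorithm started on f with the value l already found is the algorithm
    started on g, one step later ([run_blowup], [run_blowup_inv]).  The
    points of the strict transforms over the origin correspond to the roots l
    of the tangent cone a20 + a11 l + a02 l^2, whose discriminant is the one
    tested in Step 1.  If it is not zero there are two points over the origin,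
    both smooth; if it is zero there is one point, which is smooth or again a
    double point with a02 != 0.  Induction on the number of steps gives a cycle
    of implications: stopping at Step r implies a resolution by r blow-ups with
    one or two points ([run_resolution]), which implies osculation
    of a definite maximal order ([resolution_osculates]), which implies
    stopping at Step r ([osculates_run]).

    Independence of the chart.  Two charts centred at P differ by a projective
    transformation, which is not linear in the affine coordinates, so
    [resolution] itself is hard to transport.  Osculation is not: by the chain
    rule and by Euler's identity it says that F vanishes modulo t^m and its
    three partial derivatives modulo t^(m/2) along the homogeneous curve
    (t, phi(t), 1) ([contact]).  This form is insensitive to linear changes of
    the homogeneous coordinates, to rescaling of the curve, to perturbations of
    order m and to reparametrization, and these operations bring the curve back
    to the form of a graph in any other chart with a02 != 0, because
    its tangent is then not vertical ([osculates_change_coords]).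

    A chart with a02 = 0 is first replaced by one with a02 != 0 without losing
    the information in its resolution ([adapted_chart]).  The statement for
    [run] and [is_type_A] follows in [algorithm_correct]. *)

Set Implicit Arguments.
Unset Strict Implicit.
Unset Printing Implicit Defensive.

Import GRing.Theory Num.Theory.
Local Open Scope ring_scope.

Local Notation blow f l := (strict_transform 2 f (Some l)).
Local Notation i0 := (@Ordinal 3 0 isT).
Local Notation i1 := (@Ordinal 3 1 isT).
Local Notation i2 := (@Ordinal 3 2 isT).
Local Notation evc v F := (mmap (@polyC _) v F).

(** * Divisibility by powers of the indeterminate *)

Section PowersOfX.
Variable K : fieldType.
Implicit Types p q : {poly K}.

Lemma dvd_XnP m p : reflect (forall i, (i < m)%N -> p`_i = 0) ('X^m %| p).
Proof.
apply: (iffP idP) => [/dvdpP [q ->] i lt_im|p0].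
  by rewrite coefMXn lt_im.
rewrite -[p](poly_take_drop m); have -> : take_poly m p = 0.
  by apply/polyP => i; rewrite coef_take_poly coef0; case: ifP => // /p0.
by rewrite add0r dvdp_mulIr.
Qed.

Lemma dvd_Xn_mulX m p : ('X^(m.+1) %| 'X * p) = ('X^m %| p).
Proof. by rewrite exprS dvdp_mul2l ?polyX_eq0. Qed.

Lemma dvd_Xn_mulX2 m p : ('X^(m.+2) %| 'X^2 * p) = ('X^m %| p).
Proof. by rewrite expr2 -mulrA !dvd_Xn_mulX. Qed.

End PowersOfX.

(** * Blowing up a double point *)

Section BlowUp.
Variable K : fieldType.
Implicit Types (f : {poly {poly K}}) (l : K) (L : seq K).

(** The term f_i y^i contributes f_i x^i (y + l)^i, and x^(m-i) divides f_i
    when f has multiplicity m; so x^m divides the total transform, and dropping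
    the first m coefficients is an exact division. *)
Lemma total_transform_factor f m l : has_mult f m ->
  total_transform f (Some l) =
  ('X^m)%:P * strict_transform m f (Some l).
Proof.
move=> [f0 _].
have dvd i : 'X^m %| f`_i * 'X^i.
  apply/dvd_XnP => j lt_jm; rewrite coefMXn; case: ltnP => // le_ij.
  by apply: f0; rewrite subnK.
have [h def_h] : exists h, total_transform f (Some l) = ('X^m)%:P * h.
  exists (\sum_(i < size f) (f`_i * 'X^i %/ 'X^m) *: ('X + l%:P%:P) ^+ i).
  rewrite /total_transform comp_polyE mulr_sumr; apply: eq_bigr => i _.
  rewrite exprMn -rmorphXn /= !mul_polyC !scalerA; congr (_ *: _).
  by rewrite [RHS]mulrC divpK.
rewrite /strict_transform def_h; congr (_ * _).
apply/polyP => i; rewrite coef_map_id0 ?drop_poly0r // coefCM mulrC.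
by rewrite drop_polyMXn_id.
Qed.

(** Reduces the direction x = 0 to the direction y = 0 of the swapped curve. *)
Lemma swap_None f m :
  strict_transform m f None = strict_transform m (swapXY f) (Some 0).
Proof. by rewrite /strict_transform /total_transform /= polyC0 addr0. Qed.

Lemma horner_blowup f l (psi : {poly K}) : has_mult f 2 ->
  f.['X * (psi + l%:P)] = 'X^2 * (blow f l).[psi].
Proof.
move=> f2; have /(congr1 (horner^~ psi)) := total_transform_factor l f2.
by rewrite /= horner_comp !hornerE.
Qed.

(** Chain rule in y: the factor x lost on the left is why the order of
    vanishing of f_y grows by 1 under blow-up, while that of f grows by 2. *)
Lemma horner_deriv_blowup f l (psi : {poly K}) : has_mult f 2 ->
  f^`().['X * (psi + l%:P)] = 'X * (blow f l)^`().[psi].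
Proof.
move=> f2; have dZ : ('X%:P * ('X + l%:P%:P))^`() = 'X%:P :> {poly {poly K}}.
  by rewrite mul_polyC derivZ derivD derivX derivC addr0 alg_polyC.
have /(congr1 (fun g => g^`().[psi])) := total_transform_factor l f2.
rewrite /= deriv_comp dZ [in RHS]derivM derivC mul0r add0r !hornerE horner_comp !hornerE.
by move=> e; apply: (mulfI (negbT (polyX_eq0 K))); rewrite mulrC e exprS mulrA.
Qed.

Lemma branch_cons (A : nzRingType) (x : A) s :
  branch (x :: s) = 'X * (branch s + x%:P).
Proof. by rewrite /branch /= cons_poly_def commr_polyX. Qed.

Lemma branch_nil (A : nzRingType) : branch [::] = 0 :> {poly A}.
Proof. by rewrite /branch /= mulr0. Qed.

Lemma restr_blowup f l L : has_mult f 2 ->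
  restr f (l :: L) = 'X^2 * restr (blow f l) L.
Proof. by move=> f2; rewrite /restr branch_cons horner_blowup. Qed.

(** The equation for the unknown l_r is the same before and after a blow-up,
    with r shifted by one.  The identity f(x, x (y + l)) = x^2 g(x, y) is used
    over the ring of polynomials in the unknown. *)
Lemma step_poly_blowup f l L : has_mult f 2 ->
  step_poly f (l :: L) = step_poly (blow f l) L.
Proof.
move=> f2; rewrite /step_poly /= branch_cons; set B := branch _.
have /(congr1 (fun g => (map_poly (map_poly polyC) g).[B])) :=
  total_transform_factor l f2.
rewrite /= map_comp_poly horner_comp !rmorphM !rmorphD /= !map_polyC !map_polyX /=.
rewrite !hornerE /= map_polyX map_polyC /= => ->.
by rewrite -expr2 coefXnM !mulnS; congr (_ `_ _).
Qed.

Lemma contact_ge_blowup f l L k : has_mult f 2 ->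
  contact_ge f (l :: L) k.+2 <-> contact_ge (blow f l) L k.
Proof.
move=> f2; rewrite /contact_ge restr_blowup //; split => H i lt_ik.
  by have := H i.+2; rewrite coefXnM /= subn2 => -> .
rewrite coefXnM; case: ltnP => // le2i; apply: H.
by rewrite ltn_subLR.
Qed.

Lemma contact_eq_blowup f l L k : has_mult f 2 ->
  contact_eq f (l :: L) k.+2 <-> contact_eq (blow f l) L k.
Proof.
move=> f2; have := @contact_ge_blowup f l L k f2.
by rewrite /contact_eq restr_blowup // coefXnM /= subn2 /=; tauto.
Qed.

Definition shift_outcome o :=
  match o with
  | StopA r => StopA r.+1
  | StopB r => StopB r.+1
  | o => o
  end.

Lemma run_blowup f l L o : has_mult f 2 ->
  run_step (blow f l) L o -> run_step f (l :: L) (shift_outcome o).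
Proof.
move=> f2; elim=> {L o} [L|L l' |L l' o] d0.
- by apply: (@step_a _ f (l :: L)); rewrite step_poly_blowup.
- move=> c; apply: (@step_b _ f (l :: L) l'); rewrite ?step_poly_blowup //=.
  by rewrite mulnS; apply/contact_eq_blowup.
- move=> c _ r; apply: (@step_next _ f (l :: L) l'); rewrite ?step_poly_blowup //=.
  by rewrite mulnS; apply/contact_ge_blowup.
Qed.

Lemma run_blowup_inv f l L o : has_mult f 2 -> run_step f (l :: L) o ->
  exists2 o', o = shift_outcome o' & run_step (blow f l) L o'.
Proof.
move=> f2; move: {1 3}(l :: L) (erefl (l :: L)) => s def_s r.
elim: r L def_s => {s o} [s|s l'|s l' o] d0.
- move=> L ds; subst s; exists (StopA (size L).+1) => //.
  by apply: step_a; rewrite -(@step_poly_blowup _ l).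
- move=> c L ds; subst s; exists (StopB (size L).+1) => //.
  apply: (@step_b _ _ _ l'); rewrite -?(@step_poly_blowup _ l) //.
  by move: c; rewrite /= mulnS => /contact_eq_blowup; apply.
- move=> c _ IH L ds; subst s; have [o' -> r] := IH (rcons L l') erefl.
  exists o' => //; apply: (@step_next _ _ _ l'); rewrite -?(@step_poly_blowup _ l) //.
  by move: c; rewrite /= mulnS => /contact_ge_blowup; apply.
Qed.

(** The exponent for the derivative is m/2 rounded up.  It is what makes odd
    orders meaningful: for m = 2 r + 1 it forces the coefficient of x^r in phi to be
    a double root of the equation of Step r, hence tells A_(2r) from
    A_(2r-1). *)
Definition osculates f m := exists phi : {poly K},
  [/\ phi`_0 = 0, 'X^m %| f.[phi] & 'X^(uphalf m) %| f^`().[phi]].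

(** A curve through the origin is y = x (psi + l) with psi(0) = 0, where l is
    its slope; its strict transform is y = psi. *)
Lemma osculates_blowup f m : has_mult f 2 ->
  osculates f m.+2 <-> exists l, osculates (blow f l) m.
Proof.
move=> f2; split.
  move=> [phi [phi0]]; set l := phi`_1.
  have -> : phi = 'X * ((drop_poly 1 phi - l%:P) + l%:P).
    rewrite subrK -{1}[phi](poly_take_drop 1) mulrC.
    rewrite expr1 [take_poly _ _](_ : _ = 0) ?add0r //.
    by apply/polyP => -[|i]; rewrite coef_take_poly coef0.
  rewrite horner_blowup // horner_deriv_blowup // dvd_Xn_mulX2 dvd_Xn_mulX => m1 m2.
  by exists l, (drop_poly 1 phi - l%:P); rewrite coefB coef_drop_poly coefC subrr.
move=> [l [psi [psi0 d1 d2]]]; exists ('X * (psi + l%:P)); split.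
- by rewrite coefXM.
- by rewrite horner_blowup // dvd_Xn_mulX2.
- by rewrite horner_deriv_blowup // dvd_Xn_mulX.
Qed.

End BlowUp.

(** * Terms of low order *)

Section LowOrder.
Variable K : fieldType.
Implicit Types (f g : {poly {poly K}}) (l : K).

(** The equation, in the slope l, of the lines y = l x of contact >= 3. *)
Definition tangent_cone f : {poly K} :=
  (acoef f 2 0)%:P + (acoef f 1 1)%:P * 'X + (acoef f 0 2)%:P * 'X^2.

Definition cone_discr f : K :=
  acoef f 1 1 ^+ 2 - 4%:R * acoef f 2 0 * acoef f 0 2.

(** The three leading coefficients are those that meet orders at most 2. *)
Lemma take3_poly (A : comNzRingType) (p : {poly A}) :
  p = (p`_0)%:P + (p`_1)%:P * 'X + (p`_2)%:P * 'X^2 + drop_poly 3 p * 'X^3.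
Proof.
rewrite -{1}[p](poly_take_drop 3); congr (_ + _).
apply/polyP => i; rewrite coef_take_poly !coefD !coefCM coefC coefX coefXn.
by case: i => [|[|[|i]]] //=; rewrite ?mulr0 ?mulr1 ?addr0 ?add0r.
Qed.

(** Only the terms of degree at most 2 in y of f reach the column x^2 of the
    total transform: the term of y-degree k carries a factor x^k. *)
Lemma acoef_blowup f l j :
  acoef (blow f l) 0 j =
  [:: (tangent_cone f).[l]; (tangent_cone f)^`().[l]; acoef f 0 2]`_j.
Proof.
rewrite /acoef /strict_transform coef_map_id0 ?drop_poly0r // coef_drop_poly.
rewrite /= {1}[f]take3_poly.
set g := drop_poly 3 f.
set Z := 'X%:P * _.
rewrite !(comp_polyD, comp_polyM, comp_polyC, comp_polyX).
have -> : (f`_0)%:P + (f`_1)%:P * Z + (f`_2)%:P * (Z * Z) + (g \Po Z) * (Z * (Z * Z)) =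
   (f`_0 + 'X * (l%:P * f`_1) + 'X^2 * (l%:P * (l%:P * f`_2)))%:P
   + ('X * f`_1 + 'X^2 * (l%:P * f`_2 + l%:P * f`_2))%:P * 'X + ('X^2 * f`_2)%:P * 'X^2
   + ('X^3)%:P * ((g \Po Z) * ('X + l%:P%:P) ^+ 3).
  rewrite /Z; ring.
have X3 (p : {poly K}) : ('X^3 * p)`_2 = 0 by rewrite coefXnM.
rewrite !coefD !coefCM !coefC !coefX !coefXn.
rewrite /tangent_cone /acoef.
case: j => [|[|[|j]]] /=; rewrite ?(mulr0, mulr1, coef0, X3, addr0, add0r);
  rewrite ?(coefD, coefXM, coefXnM, coefCM) /= ?derivE ?nth_nil //.
  by rewrite !(hornerD, hornerM, hornerC, hornerX, hornerXn) subnn; ring.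
by rewrite !(hornerD, hornerM, hornerC, hornerX, hornerXn, hornerMn) subnn; ring.
Qed.

Lemma step_poly_nil f : step_poly f [::] = tangent_cone f.
Proof.
rewrite /step_poly /= branch_cons branch_nil add0r {1}[f]take3_poly.
rewrite !(rmorphD, rmorphM) /= !map_polyC !map_polyX /= !(hornerD, hornerM, hornerC, hornerX).
set g := (map_poly _ (drop_poly 3 f)).[_].
have -> : g * ('X * 'X%:P * ('X * 'X%:P * ('X * 'X%:P))) = 'X^3 * (g * 'X%:P ^+ 3) by ring.
set f0 := map_poly _ f`_0; set f1 := map_poly _ f`_1; set f2 := map_poly _ f`_2.
have -> : f0 + f1 * ('X * 'X%:P) + f2 * ('X * 'X%:P * ('X * 'X%:P))
    + 'X^3 * (g * 'X%:P ^+ 3)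
  = f0 + 'X * ('X%:P * f1) + 'X^2 * ('X%:P * ('X%:P * f2)) + 'X^3 * (g * 'X%:P ^+ 3).
  by ring.
rewrite muln1 !(coefD, coefXM, coefXnM, coefCM) /= !coef_map /= addr0.
by rewrite /tangent_cone /acoef; ring.
Qed.

Lemma discr_step1 f : discr2 (step_poly f [::]) = cone_discr f.
Proof.
rewrite step_poly_nil /discr2 /cone_discr /tangent_cone.
by rewrite !(coefD, coefCM, coefC, coefX, coefXn) /=; ring.
Qed.

Lemma tangent_coneE f l :
  (tangent_cone f).[l] = acoef f 2 0 + acoef f 1 1 * l + acoef f 0 2 * l ^+ 2.
Proof. by rewrite !hornerE. Qed.

Lemma deriv_tangent_coneE f l :
  (tangent_cone f)^`().[l] = acoef f 1 1 + acoef f 0 2 * l *+ 2.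
Proof.
rewrite /tangent_cone !derivE.
by rewrite !(hornerD, hornerM, hornerC, hornerX, hornerXn, hornerMn); ring.
Qed.

(** The double points to which Step 1 applies. *)
Definition double_in_y f := has_mult f 2 /\ acoef f 0 2 != 0.

Lemma double_in_y_intro f : acoef f 0 0 = 0 -> acoef f 1 0 = 0 -> acoef f 0 1 = 0 ->
  acoef f 0 2 != 0 -> double_in_y f.
Proof.
move=> f00 f10 f01 f02; split=> //; split; last by exists 0%N, 2%N.
by move=> [|[|i]] [|[|j]].
Qed.

Lemma mult1_intro f : acoef f 0 0 = 0 ->
  (acoef f 1 0 != 0) || (acoef f 0 1 != 0) -> has_mult f 1.
Proof.
move=> f00 f1; split; first by move=> [|i] [|j].
by case/orP: f1; [exists 1%N, 0%N|exists 0%N, 1%N].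
Qed.

Lemma has_mult_uniq f m m' : has_mult f m -> has_mult f m' -> m = m'.
Proof.
move=> [v [i [j [ij nz]]]] [v' [i' [j' [ij' nz']]]]; apply/eqP.
rewrite eqn_leq; apply/andP; split; rewrite leqNgt; apply/negP => lt_m.
  by move/eqP: nz'; apply; apply: v; rewrite ij'.
by move/eqP: nz; apply; apply: v'; rewrite ij.
Qed.

Lemma mult2_low f : has_mult f 2 ->
  [/\ acoef f 0 0 = 0, acoef f 1 0 = 0 & acoef f 0 1 = 0].
Proof. by move=> [v _]; split; apply: v. Qed.

Lemma resolution_smooth f r k : has_mult f 1 -> resolution f r k ->
  r = 0%N /\ k = 1%N.
Proof.
move=> f1 res; case: res f1 => // m s r' k' m2 fm _ _ _ /(has_mult_uniq fm) m1.
by rewrite m1 in m2.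
Qed.

Lemma horner_low f (phi : {poly K}) : phi`_0 = 0 ->
  (f.[phi])`_0 = acoef f 0 0 /\
  (f.[phi])`_1 = acoef f 1 0 + acoef f 0 1 * phi`_1.
Proof.
move=> phi0; have [psi def_phi] : exists psi, phi = 'X * psi.
  have /dvdpP [psi ->] : 'X^1 %| phi by apply/dvd_XnP => -[|].
  by exists psi; rewrite expr1 mulrC.
rewrite {1 3}[f]take3_poly !(hornerD, hornerM, hornerC, hornerX, hornerXn).
rewrite def_phi -!addrA; set h := _.[_]; set f0 := f`_0; set f1 := f`_1.
have -> : f0 + (f1 * ('X * psi) + (f`_2 * ('X * psi) ^+ 2 + h * ('X * psi) ^+ 3))
  = f0 + 'X * (psi * f1) + 'X^2 * (f`_2 * psi ^+ 2 + h * psi ^+ 3 * 'X) by ring.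
by rewrite !(coefD, coefXM, coefXnM) /= coef0M !addr0 mulrC.
Qed.

Lemma osculates_le f m m' : (m' <= m)%N -> osculates f m -> osculates f m'.
Proof.
move=> le_m [phi [phi0 d1 d2]]; exists phi; split => //.
  by apply: dvdp_trans d1; apply: dvdp_exp2l.
by apply: dvdp_trans d2; apply: dvdp_exp2l; apply: uphalf_leq.
Qed.

Lemma acoef_deriv0 f i : acoef f^`() i 0 = acoef f i 1.
Proof. by rewrite /acoef coef_deriv mulr1n. Qed.

Lemma osculates1 f : osculates f 1 -> acoef f 0 0 = 0 /\ acoef f 0 1 = 0.
Proof.
move=> [phi [phi0 /dvd_XnP d1 /dvd_XnP d2]].
have [<- _] := horner_low f phi0; have [e _] := horner_low f^`() phi0.
by rewrite -acoef_deriv0 -e d1 // d2.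
Qed.

Lemma osculates2 f : osculates f 2 ->
  [/\ acoef f 0 0 = 0, acoef f 1 0 = 0 & acoef f 0 1 = 0].
Proof.
move=> of2; have [f00 f01] := osculates1 (osculates_le (leqnSn 1) of2).
move: of2 => [phi [phi0 /dvd_XnP d1 _]].
have [_] := horner_low f phi0; rewrite f01 mul0r addr0 d1 //.
Qed.

Lemma osculates1_intro f : acoef f 0 0 = 0 -> acoef f 0 1 = 0 -> osculates f 1.
Proof.
move=> f00 f01; exists 0; have z : (0 : {poly K})`_0 = 0 by rewrite coef0.
have [e _] := horner_low f z; have [e' _] := horner_low f^`() z.
by split => //; apply/dvd_XnP => -[|i] // _; rewrite ?e // e' acoef_deriv0.
Qed.

Lemma osculates2_intro f : acoef f 0 0 = 0 -> acoef f 1 0 = 0 ->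
  acoef f 0 1 = 0 -> osculates f 2.
Proof.
move=> f00 f10 f01; exists 0; have z : (0 : {poly K})`_0 = 0 by rewrite coef0.
have [e e1] := horner_low f z; have [e' _] := horner_low f^`() z.
split => //; apply/dvd_XnP => -[|[|i]] // _; rewrite ?e ?e1 ?f10 ?f01 ?mul0r ?addr0 //.
by rewrite e' acoef_deriv0.
Qed.

End LowOrder.

(** * Algorithm, resolution and osculation *)

Section Resolution.
Variable K : numClosedFieldType.
Implicit Types (f g : {poly {poly K}}) (l : K).

(** Completing the square in the tangent cone. *)
Lemma cone_identity f l :
  4%:R * acoef f 0 2 * (tangent_cone f).[l] =
  (tangent_cone f)^`().[l] ^+ 2 - cone_discr f.
Proof. by rewrite tangent_coneE deriv_tangent_coneE /cone_discr; ring. Qed.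

Lemma cone_discr_double_root f l :
  (tangent_cone f).[l] = 0 -> (tangent_cone f)^`().[l] = 0 -> cone_discr f = 0.
Proof.
move=> q0 q1; have := cone_identity f l.
by rewrite q0 q1 mulr0 expr0n sub0r => /esym/eqP; rewrite oppr_eq0 => /eqP.
Qed.

Lemma cone_double_root f l : cone_discr f = 0 ->
  (tangent_cone f).[l] = 0 -> (tangent_cone f)^`().[l] = 0.
Proof.
move=> d0 q0; have := cone_identity f l; rewrite q0 d0 mulr0 subr0 => /esym/eqP.
by rewrite sqrf_eq0 => /eqP.
Qed.

Lemma cone_double_root_ex f : acoef f 0 2 != 0 -> cone_discr f = 0 ->
  exists l, forall l', ((tangent_cone f).[l'] == 0) = (l' == l).
Proof.
move=> a02 d0; exists (- acoef f 1 1 / (acoef f 0 2 *+ 2)) => l'.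
have a02' : acoef f 0 2 *+ 2 != 0 by rewrite mulrn_eq0.
have -> : ((tangent_cone f).[l'] == 0) = ((tangent_cone f)^`().[l'] == 0).
  have := cone_identity f l'; rewrite d0 subr0 => e.
  rewrite -[RHS]sqrf_eq0 -e !mulf_eq0 (negbTE a02) pnatr_eq0 //.
rewrite deriv_tangent_coneE -mulrnAl mulrC -[RHS](inj_eq (mulIf a02')) mulfVK //.
by rewrite addr_eq0 eq_sym -eqr_oppLR eq_sym.
Qed.

(** The two roots of the quadratic formula; a square root of the discriminant
    exists because the field is algebraically closed. *)
Lemma cone_two_roots f : acoef f 0 2 != 0 -> cone_discr f != 0 ->
  exists l1 l2, l1 != l2 /\
  forall l, ((tangent_cone f).[l] == 0) = (l \in [:: l1; l2]).
Proof.
move=> a02 d0; set d := sqrtC (cone_discr f).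
have d2 : d ^+ 2 = cone_discr f by rewrite sqrtCK.
have dn0 : d != 0 by rewrite sqrtC_eq0.
have a02' : acoef f 0 2 *+ 2 != 0 by rewrite mulrn_eq0.
exists ((- acoef f 1 1 + d) / (acoef f 0 2 *+ 2)).
exists ((- acoef f 1 1 - d) / (acoef f 0 2 *+ 2)); split.
  rewrite (inj_eq (mulIf _)) ?invr_eq0 // (inj_eq (addrI _)) -subr_eq0 opprK.
  by rewrite -mulr2n mulrn_eq0.
move=> l; rewrite !inE.
have -> : ((tangent_cone f).[l] == 0) =
   (((tangent_cone f)^`().[l] - d) * ((tangent_cone f)^`().[l] + d) == 0).
  rewrite -subr_sqr d2 -cone_identity !mulf_eq0 (negbTE a02) pnatr_eq0 //.
rewrite mulf_eq0 deriv_tangent_coneE -mulrnAl mulrC.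
rewrite -![l == _](inj_eq (mulIf a02')) !mulfVK //.
by congr (_ || _); rewrite -subr_eq0 -[RHS]subr_eq0; congr (_ == _); ring.
Qed.

Lemma acoef_swap f i j : acoef (swapXY f) i j = acoef f j i.
Proof. by rewrite /acoef coef_swapXY. Qed.

Lemma has_mult_swap f m : has_mult f m -> has_mult (swapXY f) m.
Proof.
move=> [v [i [j [ij nz]]]]; split.
  by move=> i' j' lt_m; rewrite acoef_swap v // addnC.
by exists j, i; rewrite acoef_swap addnC.
Qed.

Lemma point_at_None f :
  acoef (strict_transform 2 f None) 0 0 = acoef f 0 2.
Proof. by rewrite swap_None acoef_blowup /= tangent_coneE !acoef_swap; ring. Qed.

Lemma slope_at_None f :
  acoef (strict_transform 2 f None) 0 1 = acoef f 1 1.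
Proof. by rewrite swap_None acoef_blowup /= deriv_tangent_coneE !acoef_swap; ring. Qed.

(** The list required by [res_blowup] for a double point. *)
Definition exceptional_points f (s : seq (option K)) :=
  uniq s /\ forall d, (d \in s) = (acoef (strict_transform 2 f d) 0 0 == 0).

Lemma node_points f : acoef f 0 2 != 0 -> cone_discr f != 0 ->
  exists2 s, exceptional_points f s & size s = 2%N.
Proof.
move=> a02 d0; have [l1 [l2 [l12 roots]]] := cone_two_roots a02 d0.
exists [:: Some l1; Some l2] => //; split; first by rewrite /= inE andbT.
move=> [l|]; rewrite ?point_at_None ?(negbTE a02) ?inE //.
by rewrite acoef_blowup /= roots !inE.
Qed.

Lemma cusp_points f : acoef f 0 2 != 0 -> cone_discr f = 0 ->
  exists l, exceptional_points f [:: Some l].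
Proof.
move=> a02 d0; have [l roots] := cone_double_root_ex a02 d0.
exists l; split => // -[l'|]; rewrite ?point_at_None ?(negbTE a02) ?inE //.
by rewrite acoef_blowup /= roots.
Qed.

Lemma cusp_point_unique f l : acoef f 0 2 != 0 -> cone_discr f = 0 ->
  (tangent_cone f).[l] = 0 -> exceptional_points f [:: Some l].
Proof.
move=> a02 d0 q0; have [l' e] := cusp_points a02 d0.
by have := e.2 (Some l); rewrite acoef_blowup /= q0 eqxx inE => /eqP ->.
Qed.

(** At a simple root of the tangent cone the strict transform is transversal
    to the exceptional divisor: its y-derivative is the derivative of the
    tangent cone, which is not zero. *)
Lemma node_smooth f d : acoef f 0 2 != 0 -> cone_discr f != 0 ->
  acoef (strict_transform 2 f d) 0 0 = 0 -> has_mult (strict_transform 2 f d) 1.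
Proof.
move=> a02 d0; case: d => [l|]; last by move=> e; rewrite -point_at_None e eqxx in a02.
move=> q0; apply: mult1_intro => //; apply/orP; right; rewrite acoef_blowup /=.
rewrite acoef_blowup /= in q0.
by apply: contra d0 => /eqP q1; rewrite (cone_discr_double_root q0 q1).
Qed.

(** The points over the origin are determined by f, so a resolution may be
    read off along any enumeration of them. *)
Lemma resolution_inv f r k s : has_mult f 2 -> resolution f r k ->
  exceptional_points f s -> exists r' k',
  [/\ forall d, d \in s -> resolution (strict_transform 2 f d) (r' d) (k' d),
     r = (\sum_(d <- s) r' d).+1 & k = \sum_(d <- s) k' d].
Proof.
move=> f2 res [s_uniq s_mem]; case: res f2 => [f1 /(has_mult_uniq f1) //|].
move=> m s' r' k' _ fm uniq_s' mem_s' res /(has_mult_uniq fm) m2; subst m.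
exists r', k'; have p : perm_eq s' s.
  by apply: uniq_perm => // d; rewrite mem_s' s_mem.
split; try by rewrite (perm_big _ p).
by move=> d ds; apply: res; rewrite (perm_mem p).
Qed.

Lemma resolution_node_inv f r k s : has_mult f 2 -> resolution f r k ->
  exceptional_points f s ->
  {in s, forall d, has_mult (strict_transform 2 f d) 1} ->
  r = 1%N /\ k = size s.
Proof.
move=> f2 res es smooth; have [r' [k' [res' -> ->]]] := resolution_inv f2 res es.
split.
  rewrite big1_seq // => d /= ds.
  by have [] := resolution_smooth (smooth d ds) (res' d ds).
rewrite -sum1_size; apply: eq_big_seq => d ds.
by have [] := resolution_smooth (smooth d ds) (res' d ds).
Qed.

Lemma resolution_node f : double_in_y f -> cone_discr f != 0 -> resolution f 1 2.
Proof.
move=> [f2 a02] d0; have [s [uniq_s mem_s] size_s] := node_points a02 d0.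
have := @res_blowup _ f 2 s (fun=> 0%N) (fun=> 1%N) isT f2 uniq_s mem_s.
rewrite sum1_size big1_eq size_s; apply=> d; rewrite mem_s => /eqP d00.
exact: res_smooth (node_smooth a02 d0 d00).
Qed.

Lemma resolution_cusp f l r k : double_in_y f -> cone_discr f = 0 ->
  (tangent_cone f).[l] = 0 -> resolution (blow f l) r k -> resolution f r.+1 k.
Proof.
move=> [f2 a02] d0 q0 res; have [uniq_s mem_s] := cusp_point_unique a02 d0 q0.
have := @res_blowup _ f 2 [:: Some l] (fun=> r) (fun=> k) isT f2 uniq_s mem_s.
by rewrite !big_seq1; apply=> d; rewrite inE => /eqP ->.
Qed.

(** At a double root of the tangent cone the y-derivative of the strict
    transform vanishes, so that it is singular as soon as its x-derivative
    vanishes too; the coefficient a02 is unchanged. *)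
Lemma double_in_y_blowup f l : double_in_y f -> cone_discr f = 0 ->
  (tangent_cone f).[l] = 0 -> acoef (blow f l) 1 0 = 0 -> double_in_y (blow f l).
Proof.
move=> [f2 a02] d0 q0 b10; apply: double_in_y_intro; rewrite ?acoef_blowup //=.
exact: cone_double_root.
Qed.

Lemma smooth_blowup f l : (tangent_cone f).[l] = 0 ->
  acoef (blow f l) 1 0 != 0 -> has_mult (blow f l) 1.
Proof. by move=> q0 b10; apply: mult1_intro; rewrite ?b10 // acoef_blowup. Qed.

(** [two] records whether there are two points over the origin rather than
    one, that is, whether the step stopped in its part a. *)
Definition stop r (two : bool) := if two then StopA r else StopB r.

(** The order s + 1 attached to A_s, for s = 2 r - 1 and s = 2 r. *)
Definition contact_order r (two : bool) := (r.*2 + ~~ two)%N.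

Lemma contact_orderS r two : contact_order r.+1 two = (contact_order r two).+2.
Proof. by []. Qed.

Lemma restr_nil f : restr f [::] = f`_0.
Proof. by rewrite /restr branch_nil horner_coef0. Qed.

(** Induction on r.  Part a at Step 1 is a node, part b a cusp with
    smooth strict transform; otherwise the algorithm goes on as on the strict
    transform. *)
Lemma run_resolution f r two : double_in_y f -> run_step f [::] (stop r two) ->
  resolution f r (1 + two).
Proof.
elim: r f two => [|r IH] f two gf run.
  (* the first step has index 1 *)
  move: run; move def_L: [::] => L; move def_o: (stop 0 two) => o run.
  suff : o <> stop 0 two by rewrite def_o.
  by elim: run {gf def_L def_o} => [||//] {}L; case: two.
have [f2 a02] := gf.
move: run; move def_o: (stop _ two) => o run.
case: run def_o => {o} [|l|l o] d0.
- case: two => // -[->].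
  by apply: resolution_node; rewrite // -discr_step1.
- move=> c; case: two => // -[->].
  rewrite discr_step1 in d0.
  move: c => /(contact_eq_blowup l _ _ f2) []; rewrite /contact_ge restr_nil => c1 c2.
  have q0 : (tangent_cone f).[l] = 0 by rewrite -[LHS](acoef_blowup f l 0); apply: c1.
  apply: (@resolution_cusp f l) => //; apply: res_smooth.
  exact: smooth_blowup.
- move=> c run def_o; rewrite /= in run.
  rewrite discr_step1 in d0.
  move: c => /(contact_ge_blowup l _ _ f2); rewrite /contact_ge restr_nil => c.
  have q0 : (tangent_cone f).[l] = 0 by rewrite -[LHS](acoef_blowup f l 0); apply: c.
  apply: (@resolution_cusp f l) => //; apply: IH.
    by apply: double_in_y_blowup => //; apply: c.
  have [o' e run'] := run_blowup_inv f2 run.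
  suff <- : o' = stop r two by [].
  by move: def_o; rewrite e /stop; case: two; case: o' {e run'} => // ? [->].
Qed.

Lemma osculates2_double f : double_in_y f -> osculates f 2.
Proof. by move=> [/mult2_low [? ? ?] _]; apply: osculates2_intro. Qed.

(** An osculating curve of order 3 must be tangent to a double root of the
    tangent cone. *)
Lemma osculates3 f : double_in_y f -> osculates f 3 <-> cone_discr f = 0.
Proof.
move=> [f2 a02]; rewrite (osculates_blowup 1 f2); split.
  move=> [l /osculates1 []]; rewrite !acoef_blowup /=.
  exact: cone_discr_double_root.
move=> d0; have [l roots] := cone_double_root_ex a02 d0; exists l.
have /eqP q0 : (tangent_cone f).[l] == 0 by rewrite roots.
by apply: osculates1_intro; rewrite acoef_blowup //=; apply: cone_double_root.
Qed.

(** A double point with two tangents has osculation of order 2 only.  With a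
    single tangent l, every osculating curve of order at least 3 has slope l, so
    that the orders of f and of its strict transform along l differ by 2. *)
Lemma resolution_osculates f r k : resolution f r k -> double_in_y f ->
  exists two : bool, [/\ k = (1 + two)%N, osculates f (contact_order r two)
    & ~ osculates f (contact_order r two).+1].
Proof.
elim=> {f r k} [f f1 [/(has_mult_uniq f1)]//|].
move=> f m s r k _ fm uniq_s mem_s res IH gf; have [f2 a02] := gf.
have m2 := has_mult_uniq fm f2; subst m.
have [d0|d0] := eqVneq (cone_discr f) 0; last first.
  have [t et size_t] := node_points a02 d0.
  have res_f := @res_blowup _ f 2 s r k isT f2 uniq_s mem_s res.
  have [|-> ->] := resolution_node_inv f2 res_f et.
    by move=> d; rewrite et.2 => /eqP; apply: node_smooth.
  exists true; rewrite size_t; split=> //; first exact: osculates2_double.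
  by move/(osculates3 gf)/eqP; rewrite (negbTE d0).
have [l el] := cusp_points a02 d0.
have def_s : s = [:: Some l].
  apply: perm_small_eq => //; apply: uniq_perm => // d.
  by rewrite mem_s el.2.
subst s; rewrite !big_seq1.
have lin : Some l \in [:: Some l] by rewrite inE.
have := res _ lin; move: (IH _ lin) => {IH res}; move: (r _) (k _) => {}r {}k IH res.
have q0 : (tangent_cone f).[l] = 0.
  by apply/eqP; have := el.2 (Some l); rewrite lin acoef_blowup.
have osc_l n : osculates f n.+3 -> osculates (blow f l) n.+1.
  move=> /(osculates_blowup _ f2) [l' osc]; suff -> : l = l' by [].
  have [q0' _] := osculates1 (@osculates_le _ _ n.+1 1 isT osc).
  by have := el.2 (Some l'); rewrite /= q0' eqxx inE => /eqP [].
have [b10|b10] := eqVneq (acoef (blow f l) 1 0) 0.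
  have [two [-> o1 o2]] := IH (double_in_y_blowup gf d0 q0 b10).
  exists two; rewrite contact_orderS; split=> //; last by move/osc_l.
  by apply/(osculates_blowup _ f2); exists l.
have [-> ->] := resolution_smooth (smooth_blowup q0 b10) res.
exists false; split => //; first exact/osculates3.
by move=> /osc_l /osculates2 [_ /eqP]; rewrite (negbTE b10).
Qed.

(** Osculation of order at least 4 forces the strict transform along some l
    to be singular: the algorithm then continues past Step 1 with the
    value l. *)
Lemma osculates_run f r two : double_in_y f ->
  osculates f (contact_order r.+1 two) ->
  ~ osculates f (contact_order r.+1 two).+1 ->
  run_step f [::] (stop r.+1 two).
Proof.
elim: r f => [|r IH] f gf; have [f2 a02] := gf.
  case: two => /= [_ nosc|osc nosc].
    by apply: (@step_a _ f [::]); rewrite discr_step1; apply/eqP => /(osculates3 gf).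
  move: (osc) => /(osculates3 gf) d0.
  have [l roots] := cone_double_root_ex a02 d0.
  have /eqP q0 : (tangent_cone f).[l] == 0 by rewrite roots.
  apply: (@step_b _ f [::] l); rewrite ?discr_step1 //=.
  apply/contact_eq_blowup => //; split; rewrite /contact_ge restr_nil.
    by case=> // _; rewrite -[LHS]/(acoef _ 0 0) acoef_blowup.
  apply/negP => /eqP b10; apply: nosc; apply/(osculates_blowup _ f2); exists l.
  apply: osculates2_intro; rewrite ?acoef_blowup //=; exact: cone_double_root.
rewrite contact_orderS => /(osculates_blowup _ f2) [l osc] nosc.
have [b00 b10 b01] := osculates2 (@osculates_le _ _ (contact_order r.+1 two) 2 isT osc).
have q0 : (tangent_cone f).[l] = 0 by rewrite -b00 acoef_blowup.
have d0 : cone_discr f = 0.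
  by apply: (cone_discr_double_root q0); rewrite -b01 acoef_blowup.
apply: (@step_next _ f [::] l); rewrite ?discr_step1 //=.
  apply/contact_ge_blowup => //; rewrite /contact_ge restr_nil.
  by move=> [|[|]].
have -> : stop r.+2 two = shift_outcome (stop r.+1 two) by clear; case: two.
apply: run_blowup => //; apply: IH => //; first exact: double_in_y_blowup.
by move=> osc'; apply: nosc; apply/(osculates_blowup _ f2); exists l.
Qed.

(** When x = 0 is the double tangent, the only point over the origin lies in
    the direction that the slopes l do not cover, and exchanging the coordinates
    brings it into sight with the same strict transform. *)
Lemma resolution_swap f r k : has_mult f 2 -> acoef f 0 2 = 0 ->
  acoef f 1 1 = 0 -> resolution f r k ->
  double_in_y (swapXY f) /\ resolution (swapXY f) r k.
Proof.
move=> f2 a02 a11 res.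
have a20 : acoef f 2 0 != 0.
  case: f2 => _ [[|[|[|i]]] [[|[|[|j]]] [//= _]]]; rewrite ?a02 ?a11 ?eqxx //.
have gf : double_in_y (swapXY f) by split; [exact: has_mult_swap|rewrite acoef_swap].
split=> //; have e : exceptional_points f [:: None].
  split=> // -[l|]; last by rewrite point_at_None a02 eqxx inE.
  by rewrite acoef_blowup /= tangent_coneE a02 a11 !mul0r !addr0 (negbTE a20) inE.
have [r' [k' [res' -> ->]]] := resolution_inv f2 res e; rewrite !big_seq1.
have := res' None; rewrite inE eqxx swap_None => /(_ isT).
apply: resolution_cusp => //.
  by rewrite /cone_discr !acoef_swap a02 a11; ring.
by rewrite tangent_coneE !acoef_swap a02 a11; ring.
Qed.

(** Two distinct tangents, one of which is x = 0. *)
Lemma resolution_vertical_node f r k : has_mult f 2 -> acoef f 0 2 = 0 ->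
  acoef f 1 1 != 0 -> resolution f r k -> r = 1%N /\ k = 2%N.
Proof.
move=> f2 a02 a11 res.
apply: (resolution_node_inv (s := [:: None; Some (- acoef f 2 0 / acoef f 1 1)]) f2 res).
  split=> // -[l|]; last by rewrite point_at_None a02 eqxx inE.
  rewrite acoef_blowup /= tangent_coneE a02 mul0r addr0 !inE /=.
  rewrite -[Some l == _]/(l == - acoef f 2 0 / acoef f 1 1).
  by rewrite addrC addr_eq0 [_ * l]mulrC -[LHS](inj_eq (mulIf a11)) mulfVK.
move=> [l|] d_in; last first.
  by apply: mult1_intro; rewrite ?point_at_None // slope_at_None a11 orbT.
have -> : l = - acoef f 2 0 / acoef f 1 1 by move: d_in; rewrite !inE => /eqP [].
apply: mult1_intro; rewrite !acoef_blowup /= ?tangent_coneE ?deriv_tangent_coneE a02.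
  by field.
by rewrite mul0r mul0rn addr0 a11 orbT.
Qed.

End Resolution.

(** * Evaluation of polynomials, chain rule and Euler identity *)

Section Evaluation.
Variables (n : nat) (K : comNzRingType).
Implicit Types F G : {mpoly K[n]}.

(** Polynomials are generated as an algebra by constants and indeterminates;
    identities between morphisms or derivations need only be checked on
    them. *)
Lemma mpoly_alg_ind (P : {mpoly K[n]} -> Prop) :
  (forall c, P c%:MP) -> (forall i, P 'X_i) ->
  (forall F G, P F -> P G -> P (F + G)) ->
  (forall F G, P F -> P G -> P (F * G)) -> forall F, P F.
Proof.
move=> PC PX PD PM F; elim/mpolyind: F => [|c m F _ _ PF].
  by rewrite -mpolyC0; apply: PC.
apply: (PD _ _ _ PF); rewrite -mul_mpolyC; apply: (PM) => //.
rewrite mpolyXE_id; elim/big_ind: _ => [|F1 F2|i _]; [by rewrite -mpolyC1|exact: PM|].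
elim: (m i) => [|k IH]; first by rewrite expr0 -mpolyC1.
by rewrite exprS; apply: PM.
Qed.

Lemma mderivXU (i j : 'I_n) : ('X_i : {mpoly K[n]})^`M(j) = (i == j)%:R.
Proof.
rewrite mderivX mnm1E; case: eqVneq => [->|_]; last by rewrite scale0r.
by rewrite -{1}[U_(j)%MM]add0m addmK mpolyX0 scale1r.
Qed.

Variable A : comNzRingType.
Implicit Types (c : {rmorphism K -> A}) (v w : 'I_n -> A).

Lemma eq_mmap c v w F : v =1 w -> mmap c v F = mmap c w F.
Proof.
move=> vw; apply: eq_bigr => m _; congr (_ * _).
by apply: eq_bigr => i _; rewrite vw.
Qed.

Lemma mmap_morph (B : comNzRingType) (h : {rmorphism A -> B}) c
    (c' : {rmorphism K -> B}) v (w : 'I_n -> B) F :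
  (forall k, h (c k) = c' k) -> (forall i, h (v i) = w i) ->
  h (mmap c v F) = mmap c' w F.
Proof.
move=> hc hv; elim/mpoly_alg_ind: F => [k|i|F G IF IG|F G IF IG].
- by rewrite !mmapC hc.
- by rewrite !mmapX !mmap1U hv.
- by rewrite !mmapD rmorphD IF IG.
- by rewrite !rmorphM /= IF IG.
Qed.

(** Chain rule.  Both sides are derivations in F, so they agree as soon as
    they agree on the indeterminates.  It is used for d/dt along a curve, for
    the y-derivative of an affine equation and for the partial derivatives after
    a change of coordinates. *)
Lemma mmap_derivation c v (D : A -> A) F :
  {morph D : x y / x + y} -> (forall x y, D (x * y) = D x * y + x * D y) ->
  (forall k, D (c k) = 0) ->
  D (mmap c v F) = \sum_i mmap c v F^`M(i) * D (v i).
Proof.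
move=> DD DM DC; elim/mpoly_alg_ind: F => [k|j|F G IF IG|F G IF IG].
- by rewrite mmapC DC big1 // => i _; rewrite mderivC mmap0 mul0r.
- rewrite mmapX mmap1U (bigD1 j) //= big1 ?addr0 => [|i ne_ij].
    by rewrite mderivXU eqxx rmorph1 mul1r.
  by rewrite mderivXU eq_sym (negbTE ne_ij) rmorph0 mul0r.
- rewrite mmapD DD IF IG -big_split; apply: eq_bigr => i _ /=.
  by rewrite mderivD mmapD mulrDl.
- rewrite rmorphM /= DM IF IG mulr_suml mulr_sumr -big_split.
  apply: eq_bigr => i _ /=.
  by rewrite mderivM mmapD !rmorphM /=; ring.
Qed.

Lemma mmap_homog c v F d (u : A) : F \is d.-homog ->
  mmap c (fun i => u * v i) F = u ^+ d * mmap c v F.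
Proof.
move=> homF; rewrite /mmap mulr_sumr; apply: eq_big_seq => m mF.
rewrite mulrCA; congr (_ * _); have /= <- := dhomog_mf homF mF.
rewrite /mmap1 mdegE.
transitivity (\prod_i (u ^+ m i * v i ^+ m i)).
  by apply: eq_bigr => i _; rewrite exprMn.
by rewrite big_split /= prodrXr.
Qed.

Lemma mderiv_homog F d i : F \is d.-homog -> F^`M(i) \is d.-1.-homog.
Proof.
move=> homF; apply/dhomogP => m; rewrite mcoeff_msupp mcoeff_deriv => nz.
have : (m + U_(i))%MM \in msupp F.
  by rewrite mcoeff_msupp; apply: contraNneq nz => ->; rewrite mul0rn.
by move=> /(dhomog_mf homF) /=; rewrite mdegD mdeg1 addn1 => <-.
Qed.

End Evaluation.

(** Differentiate F(t v) = t^d F(v) with respect to t and set t = 1. *)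
Lemma mmap_euler n (K A : comNzRingType) (c : {rmorphism K -> A}) v
    (F : {mpoly K[n]}) d : F \is d.-homog ->
  \sum_i mmap c v F^`M(i) * v i = mmap c v F *+ d.
Proof.
move=> homF; pose cP : {rmorphism K -> {poly A}} := (polyC \o c)%FUN.
pose ev1 : {poly A} -> A := horner_eval 1.
have ev k : ev1 (cP k) = c k by rewrite /ev1 /horner_eval /= hornerC.
have evv i : ev1 ('X * (v i)%:P) = v i by rewrite /ev1 /horner_eval !hornerE.
have <- : ev1 (deriv (mmap cP (fun i => 'X * (v i)%:P) F)) = mmap c v F *+ d.
  rewrite (mmap_homog cP (fun i => (v i)%:P) 'X homF).
  rewrite -(@mmap_morph _ _ _ _ (@polyC A) c cP v) //.
  rewrite derivM derivXn derivC mulr0 addr0 /ev1 /horner_eval !hornerE.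
  by rewrite hornerMn hornerXn expr1n mulr_natl.
rewrite (@mmap_derivation _ _ _ cP _ deriv) => [|x y|x y|k]; first last.
- by rewrite /= derivC.
- exact: derivM.
- exact: derivD.
rewrite /ev1 rmorph_sum; apply: eq_bigr => i _.
rewrite rmorphM /= derivM derivX derivC mulr0 addr0 mul1r /horner_eval hornerC.
by congr (_ * _); symmetry; apply: (mmap_morph _ ev evv).
Qed.

Section ChangeCoords.
Variable K : fieldType.
Implicit Types (F G : {mpoly K[3]}) (M N : 'M[K]_3).

Lemma mmap_change_coords (A : comNzRingType) (c : {rmorphism K -> A}) v M F :
  mmap c v (change_coords M F) = mmap c (fun i => \sum_j c (M j i) * v j) F.
Proof.
rewrite /change_coords /comp_mpoly; apply: mmap_morph => [k|i] /=.
  by rewrite mmapC.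
rewrite tnth_mktuple rmorph_sum /=; apply: eq_bigr => j _.
by rewrite mmapZ mmapX mmap1U.
Qed.

Lemma mderiv_change_coords M F j :
  (change_coords M F)^`M(j) = \sum_i M j i *: change_coords M F^`M(i).
Proof.
rewrite /change_coords /comp_mpoly.
rewrite (@mmap_derivation _ _ _ _ _ (mderiv j)); first last.
- exact: mderivC.
- exact: mderivM.
- exact: mderivD.
apply: eq_bigr => i _; rewrite tnth_mktuple mulrC raddf_sum /=.
rewrite (bigD1 j) //= big1 => [|k ne_kj].
  by rewrite addr0 mderivZ mderivXU eqxx -scalerAl mul1r.
by rewrite mderivZ mderivXU (negbTE ne_kj) scaler0.
Qed.

Lemma change_coordsM M N F :
  change_coords N (change_coords M F) = change_coords (N *m M) F.
Proof.
rewrite {1}/change_coords {1}/comp_mpoly mmap_change_coords.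
apply: eq_mmap => i; rewrite tnth_mktuple.
under eq_bigr => j _ do rewrite tnth_mktuple mul_mpolyC scaler_sumr.
rewrite exchange_big; apply: eq_bigr => k _ /=.
rewrite mxE scaler_suml; apply: eq_bigr => j _.
by rewrite scalerA mulrC.
Qed.

Lemma change_coords1 F : change_coords 1%:M F = F.
Proof.
rewrite -[RHS]comp_mpoly_id; apply: eq_mmap => i; rewrite !tnth_mktuple.
rewrite (bigD1 i) //= big1 ?addr0 => [|j ne_ji]; first by rewrite mxE eqxx scale1r.
by rewrite mxE (negbTE ne_ji) scale0r.
Qed.

Lemma change_coords_homog M F d : F \is d.-homog ->
  change_coords M F \is d.-homog.
Proof.
move=> homF; rewrite /change_coords comp_mpolyE big_seq rpred_sum // => m mF.
apply: dhomogZ; have /= <- := dhomog_mf homF mF; rewrite mdegE.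
elim/big_rec2: _ => [|i k p _ hom_p]; first exact: dhomog1.
apply: dhomogM => //; rewrite tnth_mktuple.
have := @dhomogMn _ _ mdeg 1 (\sum_j M j i *: 'X_j) (m i); rewrite mul1n; apply.
by apply: rpred_sum => j _; apply: dhomogZ; rewrite dhomogX /= mdeg1.
Qed.

End ChangeCoords.

(** * Inversion and substitution modulo a power of the indeterminate *)

Section TruncatedSeries.
Variable K : fieldType.
Implicit Types p q rho h : {poly K}.

Lemma invert_mod_Xn N p : p`_0 != 0 -> exists u, 'X^N %| u * p - 1.
Proof.
move=> p0; have : coprimep 'X^N p.
  apply: coprimep_expl; rewrite coprimep_sym coprimepX.
  by rewrite -[root _ _]/(_ == 0) horner_coef0.
rewrite coprimep_sym => /Bezout_eq1_coprimepP [[u w] /= e].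
by exists u; rewrite -e opprD addNKr -mulNr dvdp_mulIr.
Qed.

(** A series rho of order exactly 1 is a local coordinate on the line, so
    every h is a polynomial in rho modulo any power of x.  The coefficients are
    found one at a time. *)
Lemma comp_approx N rho h : rho`_0 = 0 -> rho`_1 != 0 ->
  exists q, 'X^N %| h - (q \Po rho).
Proof.
move=> rho0 rho1; have [sigma def_rho] : exists sigma, rho = sigma * 'X.
  by apply/dvdpP; rewrite -['X]expr1; apply/dvd_XnP => -[|].
elim: N => [|N [q /dvdpP [k def_k]]]; first by exists 0; rewrite expr0 dvd1p.
exists (q + (k`_0 / rho`_1 ^+ N)%:P * 'X^N).
rewrite comp_polyD comp_polyM comp_polyC comp_Xn_poly opprD addrA def_k.
have sigma0 : sigma`_0 = rho`_1 by rewrite def_rho coefMX.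
have -> : k * 'X^N - (k`_0 / rho`_1 ^+ N)%:P * rho ^+ N =
   'X^N * (k - (k`_0 / rho`_1 ^+ N)%:P * sigma ^+ N).
  by rewrite {2}def_rho exprMn; ring.
rewrite exprSr dvdp_mul2l ?monic_neq0 ?monicXn // -['X]expr1.
apply/dvd_XnP => -[|//] _; rewrite coefB coefCM.
have -> : (sigma ^+ N)`_0 = rho`_1 ^+ N.
  by rewrite -!horner_coef0 horner_exp horner_coef0 sigma0.
by rewrite divfK ?subrr // expf_neq0.
Qed.

(** As rho is x times a series with invertible constant term, factors of x
    can be cancelled one at a time on both sides. *)
Lemma dvd_Xn_comp m p rho : rho`_0 = 0 -> rho`_1 != 0 ->
  'X^m %| (p \Po rho) -> 'X^m %| p.
Proof.
move=> rho0 rho1; have [sigma def_rho] : exists sigma, rho = 'X * sigma.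
  have /dvdpP [s ->] : 'X %| rho by rewrite -['X]expr1; apply/dvd_XnP => -[|].
  by exists s; rewrite mulrC.
have sigma0 : sigma`_0 = rho`_1 by rewrite def_rho coefXM.
have cop k : coprimep 'X^k sigma.
  apply: coprimep_expl; rewrite coprimep_sym coprimepX.
  by rewrite -[root _ _]/(_ == 0) horner_coef0 sigma0.
elim: m p => [|m IH] p; first by rewrite expr0 !dvd1p.
rewrite -[p](poly_take_drop 1) expr1 [take_poly 1 p](_ : _ = (p`_0)%:P); last first.
  by apply/polyP => -[|i]; rewrite coef_take_poly coefC.
set p' := drop_poly 1 p.
rewrite comp_polyD comp_polyM comp_polyC comp_polyX => dvd.
have p0 : p`_0 = 0.
  move/dvd_XnP/(_ 0%N isT): dvd; rewrite coefD coefC /= coefM big_ord1.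
  by rewrite rho0 mulr0 addr0.
move: dvd; rewrite p0 !add0r mulrC {1}def_rho -mulrA dvd_Xn_mulX Gauss_dvdpr //.
by move/IH; rewrite [p' * _]mulrC dvd_Xn_mulX.
Qed.

End TruncatedSeries.

(** * Contact of a homogeneous curve with a plane curve *)

Definition tri (A : Type) (x y z : A) (i : 'I_3) : A := nth z [:: x; y] i.

Lemma sum3 (V : nmodType) (f : 'I_3 -> V) : \sum_i f i = f i0 + f i1 + f i2.
Proof.
rewrite !big_ord_recl big_ord0 addr0 addrA.
by congr (f _ + f _ + f _); apply: val_inj.
Qed.

Lemma forall3 (P : 'I_3 -> Prop) : P i0 -> P i1 -> P i2 -> forall i, P i.
Proof.
by move=> p0 p1 p2 [[|[|[|//]]] lt_i]; [move: p0|move: p1|move: p2];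
  congr P; apply: val_inj.
Qed.

Section AffineChart.
Variable K : fieldType.
Implicit Types (F G : {mpoly K[3]}) (phi rho u : {poly K}) (v w : 'I_3 -> {poly K}).

Lemma dehomogE F :
  dehomog F = mmap (polyC \o @polyC K) (tri 'X%:P 'X 1) F.
Proof. by apply: eq_mmap; apply: forall3. Qed.

Lemma horner_dehomog F phi : (dehomog F).[phi] = evc (tri 'X phi 1) F.
Proof.
rewrite dehomogE -[LHS]/(horner_eval phi _).
apply: (@mmap_morph _ _ _ _ (horner_eval phi)) => [k|]; first exact: hornerC.
by apply: forall3; [exact: hornerC|exact: hornerX|exact: hornerC].
Qed.

Lemma deriv_dehomog F : (dehomog F)^`() = dehomog F^`M(i1).
Proof.
rewrite !dehomogE (@mmap_derivation _ _ _ _ _ (@deriv _)); first last.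
- by move=> k /=; rewrite derivC.
- exact: derivM.
- exact: derivD.
by rewrite sum3 /= !derivC derivX !mulr0 mulr1 add0r addr0.
Qed.

Lemma deriv_evc v F : (evc v F)^`() = \sum_i evc v F^`M(i) * (v i)^`().
Proof.
by apply: mmap_derivation; [exact: derivD|exact: derivM|move=> k; rewrite derivC].
Qed.

Lemma evc_comp v F rho : evc v F \Po rho = evc (fun i => v i \Po rho) F.
Proof.
rewrite -[LHS]/(comp_poly rho _).
by apply: (@mmap_morph _ _ _ _ (comp_poly rho)) => // k; rewrite /= comp_polyC.
Qed.

(** Interpolate linearly between v and w: F(w + a d) is a polynomial in a,
    hence its values at a = x^m and a = 0 are congruent modulo x^m. *)
Lemma evc_mod m v w F : (forall i, 'X^m %| v i - w i) ->
  'X^m %| evc v F - evc w F.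
Proof.
move=> vw; pose d i := (v i - w i) %/ 'X^m.
have def_v i : v i = w i + 'X^m * d i by rewrite mulrC divpK // addrC subrK.
pose p := mmap (polyC \o @polyC K) (fun i => (w i)%:P + 'X * (d i)%:P) F.
have ev a : p.[a] = evc (fun i => w i + a * d i) F.
  rewrite -[LHS]/(horner_eval a _).
  apply: (@mmap_morph _ _ _ _ (horner_eval a)) => [k|i]; first exact: hornerC.
  by rewrite /= /horner_eval !hornerE.
have -> : evc v F = p.['X^m] by rewrite ev; apply: eq_mmap.
have -> : evc w F = p.[0] by rewrite ev; apply: eq_mmap => i; rewrite mul0r addr0.
rewrite -[p](poly_take_drop 1) expr1.
rewrite [take_poly 1 p](_ : _ = (p`_0)%:P); last first.
  by apply/polyP => -[|i]; rewrite coef_take_poly coefC.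
by rewrite !hornerE [X in X - _]addrC addrK dvdp_mulIr.
Qed.

(** The form of osculation that does not depend on the chart; v is a curve in
    homogeneous coordinates. *)
Definition contact F m v :=
  'X^m %| evc v F /\ forall i, 'X^(uphalf m) %| evc v F^`M(i).

Lemma uphalf_le m : (uphalf m <= m)%N.
Proof. by rewrite -{2}(odd_double_half m) uphalf_half leq_add2l -addnn leq_addl. Qed.

Lemma contact_mod F m v w : (forall i, 'X^m %| v i - w i) ->
  contact F m v -> contact F m w.
Proof.
move=> vw [d0 d1]; split => [|i].
  by rewrite -(dvdp_subr _ d0) evc_mod.
rewrite -(dvdp_subr _ (d1 i)); apply: dvdp_trans (evc_mod _ vw).
by apply: dvdp_exp2l; apply: uphalf_le.
Qed.

Lemma contact_scale F d m u v : F \is d.-homog ->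
  contact F m v -> contact F m (fun i => u * v i).
Proof.
move=> homF [d0 d1]; split => [|i]; first by rewrite (mmap_homog _ _ _ homF) dvdp_mull.
by rewrite (mmap_homog _ _ _ (mderiv_homog i homF)) dvdp_mull.
Qed.

Lemma contact_comp F m v rho : rho`_0 = 0 -> rho`_1 != 0 ->
  contact F m (fun i => v i \Po rho) -> contact F m v.
Proof.
move=> rho0 rho1 [d0 d1]; split => [|i].
  by apply: (dvd_Xn_comp rho0 rho1); rewrite evc_comp.
by apply: (dvd_Xn_comp rho0 rho1); rewrite evc_comp.
Qed.

Lemma contact_change_coords F m (M : 'M[K]_3) v w :
  (forall i, v i = \sum_j (M j i)%:P * w j) ->
  contact F m v -> contact (change_coords M F) m w.
Proof.
move=> def_v [d0 d1].
have cc G : evc w (change_coords M G) = evc v G.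
  by rewrite mmap_change_coords; apply: eq_mmap => i; rewrite def_v.
split=> [|j]; first by rewrite cc.
rewrite mderiv_change_coords raddf_sum /=.
elim/big_ind: _ => [|p q|i _]; [exact: dvdp0|exact: dvdp_add|].
by rewrite mmapZ cc dvdp_mull.
Qed.

Lemma contact_osculates F m phi : phi`_0 = 0 ->
  contact F m (tri 'X phi 1) -> osculates (dehomog F) m.
Proof.
move=> phi0 [d0 d1]; exists phi; rewrite horner_dehomog; split => //.
by rewrite deriv_dehomog horner_dehomog.
Qed.

(** F_x is recovered by differentiating F(x, phi(x), 1), which costs one
    order; since m - 1 >= m/2 rounded up for m >= 2, this is harmless.  Then
    F_z follows from Euler's identity. *)
Lemma osculates_contact F d m phi : F \is d.-homog -> (1 < m)%N ->
  'X^m %| (dehomog F).[phi] -> 'X^(uphalf m) %| (dehomog F)^`().[phi] ->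
  contact F m (tri 'X phi 1).
Proof.
move=> homF m1; rewrite deriv_dehomog !horner_dehomog => d0 dy; split => //.
have dF : 'X^(uphalf m) %| evc (tri 'X phi 1) F.
  by apply: dvdp_trans d0; apply: dvdp_exp2l; apply: uphalf_le.
have dx : 'X^(uphalf m) %| evc (tri 'X phi 1) F^`M(i0).
  have := deriv_evc (tri 'X phi 1) F.
  rewrite sum3 /= derivX derivC mulr0 addr0 mulr1 => /eqP.
  rewrite -subr_eq => /eqP <-; apply: dvdp_sub; last exact: dvdp_mulr.
  have /dvdpP [q ->] := d0; rewrite derivM derivXn; apply: dvdp_add.
    by apply: dvdp_mull; apply: dvdp_exp2l; apply: uphalf_le.
  rewrite mulrnAr -mulrnAl; apply: dvdp_mull; apply: dvdp_exp2l.
  by case: m m1 {d0 dy dF} => [|[|m]] // _; rewrite /= ltnS uphalf_le.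
apply: forall3 => //.
have := mmap_euler (@polyC K) (tri 'X phi 1) homF.
rewrite sum3 /= mulr1 => /eqP; rewrite addrC eq_sym -subr_eq => /eqP <-.
by rewrite dvdp_sub ?dvdp_add ?dvdp_mulr // -mulr_natl dvdp_mull.
Qed.

End AffineChart.

(** * Transport between charts *)

Section Charts.
Variable K : numClosedFieldType.
Implicit Types (F G : {mpoly K[3]}) (phi : {poly K}) (v w : 'I_3 -> {poly K}).
Implicit Types (C M : 'M[K]_3).

Definition at_origin F : K := mmap idfun (tri 0 0 1) F.

Lemma evc_coef0 v F : (forall i, (v i)`_0 = tri 0 0 1 i) ->
  (evc v F)`_0 = at_origin F.
Proof.
move=> v0; rewrite -horner_coef0 -[LHS]/(horner_eval 0 _).
apply: (@mmap_morph _ _ _ _ (horner_eval 0)) => [k|i]; first exact: hornerC.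
by rewrite -v0 -horner_coef0.
Qed.

Lemma evc_coef1 v F : (forall i, (v i)`_0 = tri 0 0 1 i) ->
  (evc v F)`_1 = \sum_i at_origin F^`M(i) * (v i)`_1.
Proof.
move=> v0; have := congr1 (fun p : {poly K} => p`_0) (deriv_evc v F).
rewrite coef_deriv mulr1n => ->; rewrite coef_sum; apply: eq_bigr => i _.
by rewrite coef0M evc_coef0 // coef_deriv mulr1n.
Qed.

Lemma line_coef0 (i : 'I_3) : (tri ('X : {poly K}) 0 1 i)`_0 = tri 0 0 1 i.
Proof. by move: i; apply: forall3; rewrite /= ?coefX ?coef0 ?coef1. Qed.

Lemma acoef_dehomog0 F i :
  acoef (dehomog F) i 0 = (evc (tri 'X 0 1) F)`_i.
Proof. by rewrite /acoef -horner_coef0 horner_dehomog. Qed.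

Lemma acoef_dehomog00 F : acoef (dehomog F) 0 0 = at_origin F.
Proof. by rewrite acoef_dehomog0 (evc_coef0 F line_coef0). Qed.

Lemma acoef_dehomog10 F : acoef (dehomog F) 1 0 = at_origin F^`M(i0).
Proof.
rewrite acoef_dehomog0 (evc_coef1 F line_coef0) sum3 /= coefX coef0 coefC.
by rewrite !mulr0 !addr0 mulr1.
Qed.

Lemma acoef_dehomog20 F :
  acoef (dehomog F) 2 0 *+ 2 = at_origin F^`M(i0)^`M(i0).
Proof.
rewrite acoef_dehomog0 -coef_deriv deriv_evc sum3 /= derivX.
have -> : (tri ('X : {poly K}) 0 1 i2)^`() = 0 by rewrite -[tri _ _ _ _]polyC1 derivC.
by rewrite deriv0 !mulr0 mulr1 !addr0 -acoef_dehomog0 acoef_dehomog10.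
Qed.

Lemma acoef_dehomog_dy F i j :
  acoef (dehomog F) i j.+1 *+ j.+1 = acoef (dehomog F^`M(i1)) i j.
Proof. by rewrite -deriv_dehomog /acoef coef_deriv coefMn. Qed.

Lemma acoef_dehomog01 F : acoef (dehomog F) 0 1 = at_origin F^`M(i1).
Proof. by rewrite -acoef_dehomog00 -acoef_dehomog_dy. Qed.

Lemma acoef_dehomog11 F :
  acoef (dehomog F) 1 1 = at_origin F^`M(i1)^`M(i0).
Proof. by rewrite -acoef_dehomog10 -acoef_dehomog_dy. Qed.

Lemma acoef_dehomog02 F :
  acoef (dehomog F) 0 2 *+ 2 = at_origin F^`M(i1)^`M(i1).
Proof. by rewrite -acoef_dehomog01 -acoef_dehomog_dy. Qed.

(** C describes a transition between two charts centred at the same point. *)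
Definition fixes_origin C (b : K) :=
  [/\ C \in unitmx, b != 0 & origin K *m C = b *: origin K].

Lemma fixes_originE C b i : fixes_origin C b -> C i2 i = b * tri 0 0 1 i.
Proof.
move=> [_ _ /matrixP /(_ 0 i)]; rewrite /origin -rowE !mxE eqxx /=.
have -> : ord_max = i2 :> 'I_3 by apply: val_inj.
by move=> ->; congr (_ * _); move: i; apply: forall3.
Qed.

Lemma fixes_origin_inv C b : fixes_origin C b -> fixes_origin (invmx C) b^-1.
Proof.
move=> [uC nz_b e]; split; rewrite ?unitmx_inv ?invr_eq0 //.
apply: (can_inj (mulmxK uC)); rewrite mulmxKV // -scalemxAl e scalerA mulVf //.
by rewrite scale1r.
Qed.

Lemma at_origin_change_coords F d C b : F \is d.-homog -> fixes_origin C b ->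
  at_origin (change_coords C F) = b ^+ d * at_origin F.
Proof.
move=> homF fC; rewrite /at_origin (mmap_change_coords idfun).
rewrite -(mmap_homog _ _ _ homF); apply: eq_mmap => i.
by rewrite sum3 /= !mulr0 !add0r mulr1 (fixes_originE i fC).
Qed.

Definition singular F :=
  at_origin F = 0 /\ forall i, at_origin F^`M(i) = 0.
Definition flat F := forall i j, at_origin F^`M(i)^`M(j) = 0.

Lemma singularP F d : F \is d.-homog -> singular F <->
  [/\ at_origin F = 0, at_origin F^`M(i0) = 0 & at_origin F^`M(i1) = 0].
Proof.
move=> homF; split=> [[? ?]//|[F0 Fx Fy]]; split => //; apply: forall3 => //.
have := mmap_euler idfun (tri 0 0 1) homF.
by rewrite sum3 /= !mulr0 !add0r mulr1 -!/(at_origin _) F0 mul0rn.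
Qed.

(** Multiplicity 2 in homogeneous terms: all first partial derivatives vanish
    at the point and the second ones do not all vanish.  Euler's identity takes
    care of those that involve the third coordinate; characteristic 0 is used to
    divide a20 and a02 by 2. *)
Lemma has_mult2P F d : F \is d.-homog ->
  has_mult (dehomog F) 2 <-> singular F /\ ~ flat F.
Proof.
move=> homF; rewrite (singularP homF); split.
  move=> f2; have [] := mult2_low f2.
  rewrite acoef_dehomog00 acoef_dehomog10 acoef_dehomog01 => F0 Fx Fy.
  split=> // flatF; case: f2 => _.
  have nat2 : (2%:R : K) != 0 by rewrite pnatr_eq0.
  case=> [[|[|[|i]]] [[|[|[|j]]] [//= _]]] /negP; apply; apply/eqP.
  - by apply: (mulIf nat2); rewrite mul0r mulr_natr acoef_dehomog02.
  - by rewrite acoef_dehomog11.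
  - by apply: (mulIf nat2); rewrite mul0r mulr_natr acoef_dehomog20.
move=> [[F0 Fx Fy] nflat]; split.
  by move=> [|[|i]] [|[|j]] // _;
    rewrite ?acoef_dehomog00 ?acoef_dehomog10 ?acoef_dehomog01.
have [a20|a20] := eqVneq (acoef (dehomog F) 2 0) 0; last by exists 2%N, 0%N.
have [a11|a11] := eqVneq (acoef (dehomog F) 1 1) 0; last by exists 1%N, 1%N.
have [a02|a02] := eqVneq (acoef (dehomog F) 0 2) 0; last by exists 0%N, 2%N.
case: nflat.
have sing : singular F by apply/(singularP homF).
have Fi2 i : at_origin F^`M(i)^`M(i2) = 0.
  have := mmap_euler idfun (tri 0 0 1) (mderiv_homog i homF).
  by rewrite sum3 /= !mulr0 !add0r mulr1 -!/(at_origin _) sing.2 mul0rn.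
apply: forall3; apply: forall3 => //.
- by rewrite -acoef_dehomog20 a20 mul0rn.
- by rewrite mderiv_comm -acoef_dehomog11.
- by rewrite -acoef_dehomog11.
- by rewrite -acoef_dehomog02 a02 mul0rn.
- by rewrite mderiv_comm.
- by rewrite mderiv_comm.
Qed.

Lemma singular_change_coords F d C b : F \is d.-homog -> fixes_origin C b ->
  singular F -> singular (change_coords C F).
Proof.
move=> homF fC [F0 F1]; split; first by rewrite (at_origin_change_coords homF fC) F0 mulr0.
move=> j; rewrite mderiv_change_coords /at_origin raddf_sum big1 // => i _ /=.
rewrite mmapZ -/(at_origin _).
by rewrite (at_origin_change_coords (mderiv_homog i homF) fC) F1 !mulr0.
Qed.

(** The chain rule applied twice. *)
Lemma hessian_change_coords F d C b j k : F \is d.-homog -> fixes_origin C b ->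
  at_origin (change_coords C F)^`M(j)^`M(k) =
  b ^+ d.-2 * \sum_i \sum_l C j i * C k l * at_origin F^`M(i)^`M(l).
Proof.
move=> homF fC; rewrite mderiv_change_coords raddf_sum /at_origin raddf_sum mulr_sumr.
apply: eq_bigr => i _; rewrite /= mderivZ mmapZ mderiv_change_coords.
rewrite raddf_sum !mulr_sumr; apply: eq_bigr => l _ /=.
rewrite mmapZ -/(at_origin _).
rewrite (at_origin_change_coords (mderiv_homog l (mderiv_homog i homF)) fC).
by rewrite -/(at_origin _) /=; ring.
Qed.

Lemma flat_change_coords F d C b : F \is d.-homog -> fixes_origin C b ->
  flat F -> flat (change_coords C F).
Proof.
move=> homF fC flatF j k; rewrite (hessian_change_coords _ _ homF fC).
rewrite big1 ?mulr0 // => i _; rewrite big1 // => l _.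
by rewrite flatF mulr0.
Qed.

Lemma change_coordsK F C : C \in unitmx ->
  change_coords (invmx C) (change_coords C F) = F.
Proof. by move=> uC; rewrite change_coordsM mulVmx // change_coords1. Qed.

Lemma has_mult2_change_coords F d C b : F \is d.-homog -> fixes_origin C b ->
  has_mult (dehomog F) 2 -> has_mult (dehomog (change_coords C F)) 2.
Proof.
move=> homF fC; have homG := change_coords_homog C homF.
move=> /(has_mult2P homF) [sF nflat]; apply/(has_mult2P homG); split.
  exact: singular_change_coords homF fC sF.
move=> flatG; apply: nflat; have [uC _ _] := fC.
rewrite -(change_coordsK F uC).
exact: flat_change_coords homG (fixes_origin_inv fC) flatG.
Qed.

(** Let w be the osculating curve (x, phi, 1) in the new homogeneous
    coordinates.  Divide it by its third coordinate modulo x^m to get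
    t = (rho, psi, 1) up to order m, and take rho as parameter: t becomes the
    graph of some q.  That rho has order 1 follows from a02 != 0 and m >= 3:
    in the new chart, differentiating G_y = 0 along t gives
    a11 rho' + 2 a02 psi' = 0 at the origin, so that rho' = 0 would make the
    tangent vector of t vanish. *)
Lemma osculates_change_coords F d C b m : F \is d.-homog -> fixes_origin C b ->
  (2 < m)%N -> acoef (dehomog (change_coords C F)) 0 2 != 0 ->
  osculates (dehomog F) m -> osculates (dehomog (change_coords C F)) m.
Proof.
move=> homF fC m3 a02 [phi [phi0 dF dyF]].
have [uC _ _] := fC; set G := change_coords C F in a02 *.
have homG : G \is d.-homog := change_coords_homog C homF.
have cF := osculates_contact homF (ltnW m3) dF dyF.
pose B := invmx C; have fB : fixes_origin B b^-1 := fixes_origin_inv fC.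
pose v := tri 'X phi 1.
pose w i : {poly K} := \sum_j (B j i)%:P * v j.
have v_w i : v i = \sum_j (C j i)%:P * w j.
  under eq_bigr => j _ do rewrite mulr_sumr.
  rewrite exchange_big /=.
  transitivity (\sum_k ((B *m C) k i)%:P * v k).
    rewrite mulVmx // (bigD1 i) //= big1 ?addr0 => [|k ne_ki].
      by rewrite mxE eqxx mul1r.
    by rewrite mxE (negbTE ne_ki) mul0r.
  apply: eq_bigr => k _; rewrite mxE raddf_sum mulr_suml; apply: eq_bigr => j _.
  by rewrite /= polyCM mulrCA mulrA.
have cG : contact G m w := contact_change_coords v_w cF.
have w0 i : (w i)`_0 = b^-1 * tri 0 0 1 i.
  rewrite coef_sum sum3 !coefCM /= coefX phi0 coef1 !mulr0 !add0r mulr1.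
  exact: fixes_originE.
have w1 i : (w i)`_1 = B i0 i + B i1 i * phi`_1.
  by rewrite coef_sum sum3 !coefCM /= coefX coef1 mulr1 mulr0 addr0.
have nzb : b^-1 != 0 by have [] := fB.
have [u def_u] : exists u, 'X^m %| u * w i2 - 1.
  by apply: invert_mod_Xn; rewrite w0 mulr1.
pose t i := u * w i.
have cGt : contact G m t := contact_scale u homG cG.
have t2 : (t i2)`_0 = 1 /\ (t i2)`_1 = 0.
  have /dvd_XnP e := def_u.
  have := e 0%N (ltnW (ltnW m3)); have := e 1%N (ltnW m3).
  by rewrite !coefB !coef1 subr0 => -> /eqP; rewrite subr_eq0 => /eqP.
have u0 : u`_0 != 0.
  apply: contra_eq_neq t2.1 => u0; rewrite coef0M u0 mul0r eq_sym.
  exact: oner_neq0.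
have t0 i : (t i)`_0 = tri 0 0 1 i.
  by move: i; apply: forall3; rewrite ?t2.1 // coef0M w0 !mulr0.
have t1 (i : 'I_3) : (i < 2)%N -> (t i)`_1 = u`_0 * (w i)`_1.
  move=> lt_i2; rewrite coefM !big_ord_recl big_ord0 /= w0.
  by rewrite (_ : tri 0 0 1 i = 0 :> K) ?mulr0 ?addr0 //; case: i lt_i2 => [[|[|]]].
pose rho := t i0; have rho1 : rho`_1 != 0.
  apply/eqP => rho1.
  have psi1 : (t i1)`_1 = 0.
    have /dvd_XnP/(_ 1%N) := cGt.2 i1.
    rewrite (evc_coef1 _ t0) sum3 -/rho rho1 t2.2 !mulr0 add0r addr0.
    rewrite -acoef_dehomog02 => /(_ _)/eqP; rewrite mulf_eq0 mulrn_eq0 (negbTE a02) /=.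
    by case: m m3 {cF cG cGt def_u dF dyF} => [|[|[|m]]] // _ /(_ isT)/eqP.
  (* rho' = psi' = 0 says that B sends the tangent vector z of (x, phi, 1) to
     a multiple of the origin, hence that z is itself such a multiple *)
  pose z : 'rV[K]_3 := \row_i tri 1 phi`_1 0 i.
  have w1_0 (i : 'I_3) : (i < 2)%N -> (t i)`_1 = 0 -> (w i)`_1 = 0.
    by move=> lt_i2 /eqP; rewrite t1 // mulf_eq0 (negbTE u0) => /eqP.
  have zB : z *m B = (w i2)`_1 *: origin K.
    have zBE i : (z *m B) 0 i = (w i)`_1.
      by rewrite w1 mxE sum3 !mxE /= mul1r mul0r addr0 [_ * B _ _]mulrC.
    apply/rowP; apply: forall3; rewrite zBE !mxE /= ?mulr0 ?mulr1 //.
      by rewrite w1_0.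
    by rewrite w1_0.
  have /(congr1 (fun y : 'rV_3 => y 0 i0)) := congr1 (mulmx^~ C) zB.
  have [_ _ eC] := fC; rewrite /= mulmxKV // -scalemxAl eC !mxE /= !mulr0 => /eqP.
  by rewrite oner_eq0.
have [q def_q] := comp_approx m (t i1) (t0 i0) rho1.
apply: (contact_osculates (phi := q)).
  have /dvd_XnP/(_ 0%N (ltnW (ltnW m3))) := def_q.
  rewrite coefB t0 -horner_coef0 horner_comp horner_coef0 (t0 i0) sub0r.
  by move/eqP; rewrite oppr_eq0 horner_coef0 => /eqP.
apply: (contact_comp (t0 i0) rho1); apply: contact_mod cGt.
apply: forall3 => //=; first by rewrite comp_polyX subrr dvdp0.
by rewrite comp_polyC.
Qed.

End Charts.

(** * Charts in which x = 0 is not a tangent *)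

Section Adapted.
Variable K : numClosedFieldType.
Implicit Types (F G : {mpoly K[3]}) (C M : 'M[K]_3).

Definition swap_mx : 'M[K]_3 :=
  \matrix_(j, i) tri (tri 0 1 0 i) (tri 1 0 0 i) (tri 0 0 1 i) j.

(** The change of coordinates (x, y) -> (x + a y, y). *)
Definition shear_mx (a : K) : 'M[K]_3 :=
  \matrix_(j, i) tri (tri 1 0 0 i) (tri a 1 0 i) (tri 0 0 1 i) j.

Lemma fixes_origin_intro C C' : C' *m C = 1%:M ->
  (forall i, C i2 i = tri 0 0 1 i) -> fixes_origin C 1.
Proof.
move=> CC e; split; rewrite ?oner_neq0 //; first by have [] := mulmx1_unit CC.
have -> : origin K = delta_mx 0 i2 by rewrite /origin; congr delta_mx; apply: val_inj.
rewrite -rowE scale1r; apply/rowP => i; rewrite !mxE e.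
by move: i; apply: forall3.
Qed.

Lemma fixes_origin_swap : fixes_origin swap_mx 1.
Proof.
apply: (@fixes_origin_intro _ swap_mx) => [|i]; last by rewrite mxE.
apply/matrixP; apply: forall3; apply: forall3;
  rewrite !mxE sum3 !mxE -!val_eqE /tri /=; ring.
Qed.

Lemma fixes_origin_shear a : fixes_origin (shear_mx a) 1.
Proof.
apply: (@fixes_origin_intro _ (shear_mx (- a))) => [|i]; last by rewrite mxE.
apply/matrixP; apply: forall3; apply: forall3;
  rewrite !mxE sum3 !mxE -!val_eqE /tri /=; ring.
Qed.

Lemma fixes_origin1 : fixes_origin (1%:M : 'M[K]_3) 1.
Proof. by split; rewrite ?unitmx1 ?oner_neq0 ?mulmx1 ?scale1r. Qed.

Lemma dehomog_swap F : dehomog (change_coords swap_mx F) = swapXY (dehomog F).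
Proof.
pose cc : {rmorphism K -> {poly {poly K}}} := (polyC \o @polyC K)%FUN.
pose sw : {rmorphism {poly {poly K}} -> {poly {poly K}}} := @swapXY K.
have swE : sw (mmap cc (tri 'X%:P 'X 1) F) = mmap cc (tri 'X 'X%:P 1) F.
  apply: (@mmap_morph _ _ _ _ sw cc cc).
    by move=> k; rewrite /= swapXY_polyC map_polyC.
  by apply: forall3; [exact: swapXY_Y|exact: swapXY_X|exact: rmorph1].
rewrite !dehomogE (mmap_change_coords cc) -[swapXY _]/(sw _).
transitivity (mmap cc (tri 'X 'X%:P 1) F); last by rewrite -swE.
apply: eq_mmap; apply: forall3; rewrite sum3 !mxE /tri /=.
- by rewrite !(rmorph0, rmorph1, mul0r, mul1r, add0r, addr0).
- by rewrite !(rmorph0, rmorph1, mul0r, mul1r, add0r, addr0).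
- by rewrite !(rmorph0, rmorph1, mul0r, mul1r, add0r, addr0).
Qed.

Lemma shear_hessian F d a (G := change_coords (shear_mx a) F) :
  F \is d.-homog ->
  [/\ at_origin G^`M(i0)^`M(i0) = at_origin F^`M(i0)^`M(i0),
      at_origin G^`M(i1)^`M(i0) =
        at_origin F^`M(i1)^`M(i0) + a * at_origin F^`M(i0)^`M(i0)
    & at_origin G^`M(i1)^`M(i1) = at_origin F^`M(i1)^`M(i1)
        + a * at_origin F^`M(i1)^`M(i0) *+ 2 + a ^+ 2 * at_origin F^`M(i0)^`M(i0)].
Proof.
move=> homF; rewrite /G !(hessian_change_coords _ _ homF (fixes_origin_shear a)).
rewrite expr1n !sum3 !mxE /tri /= (mderiv_comm i0 i1).
by split; ring.
Qed.

Lemma cone_discr_hessian F : cone_discr (dehomog F) =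
  at_origin F^`M(i1)^`M(i0) ^+ 2
  - at_origin F^`M(i0)^`M(i0) * at_origin F^`M(i1)^`M(i1).
Proof.
rewrite /cone_discr acoef_dehomog11 -acoef_dehomog20 -acoef_dehomog02; ring.
Qed.

(** If a02 = 0, either x = 0 is a double tangent and the coordinates are
    exchanged, or it is one of two distinct tangents.  In the second case
    the resolution is that of a node, and a generic shear gives a node with
    a02 != 0, the discriminant of the tangent cone being unchanged. *)
Lemma adapted_chart F d r k : F \is d.-homog ->
  has_mult (dehomog F) 2 -> resolution (dehomog F) r k ->
  exists C, exists2 two : bool,
    fixes_origin C 1 /\ acoef (dehomog (change_coords C F)) 0 2 != 0 &
    [/\ k = (1 + two)%N,
      osculates (dehomog (change_coords C F)) (contact_order r two)
    & ~ osculates (dehomog (change_coords C F)) (contact_order r two).+1].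
Proof.
move=> homF f2 res; have [a02|a02] := eqVneq (acoef (dehomog F) 0 2) 0; last first.
  have [two osc] := resolution_osculates res (conj f2 a02).
  by exists 1%:M, two; rewrite change_coords1; [split=> //; exact: fixes_origin1|].
have [a11|a11] := eqVneq (acoef (dehomog F) 1 1) 0.
  have [gs res_s] := resolution_swap f2 a02 a11 res.
  have [two osc] := resolution_osculates res_s gs.
  exists swap_mx, two; rewrite dehomog_swap //.
  by split; [exact: fixes_origin_swap|case: gs].
have [-> ->] := resolution_vertical_node f2 a02 a11 res.
have F11 : at_origin F^`M(i1)^`M(i1) = 0 by rewrite -acoef_dehomog02 a02 mul0rn.
have F10 : at_origin F^`M(i1)^`M(i0) != 0 by rewrite -acoef_dehomog11.
(* a02 becomes a (a a20 + a11); as a11 != 0, this is nonzero for a = 1 or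
   for a = -1 *)
have [a Ha] : exists a : K,
    a * at_origin F^`M(i1)^`M(i0) *+ 2 + a ^+ 2 * at_origin F^`M(i0)^`M(i0) != 0.
  set b := at_origin F^`M(i1)^`M(i0) in F10 *; set c := at_origin _.
  have [e|] := eqVneq (1 * b *+ 2 + 1 ^+ 2 * c) 0; last by exists 1.
  exists (-1); have -> : -1 * b *+ 2 + (-1) ^+ 2 * c
    = (1 * b *+ 2 + 1 ^+ 2 * c) - b *+ 4 by ring.
  by rewrite e sub0r oppr_eq0 mulrn_eq0.
have [G00 G10 G11] := shear_hessian a homF.
have fS := fixes_origin_shear a.
have a02G : acoef (dehomog (change_coords (shear_mx a) F)) 0 2 != 0.
  have : acoef (dehomog (change_coords (shear_mx a) F)) 0 2 *+ 2 != 0.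
    by rewrite acoef_dehomog02 G11 F11 add0r.
  by rewrite mulrn_eq0.
have gG : double_in_y (dehomog (change_coords (shear_mx a) F)).
  by split=> //; apply: has_mult2_change_coords homF fS f2.
exists (shear_mx a), true; split => //; first exact: osculates2_double.
move=> /(osculates3 gG) /eqP; rewrite cone_discr_hessian G00 G10 G11 F11.
rewrite [X in X == 0](_ : _ = at_origin F^`M(i1)^`M(i0) ^+ 2); last by ring.
by rewrite sqrf_eq0 (negbTE F10).
Qed.

End Adapted.

(** * Correctness of the algorithm *)

Section Main.
Variable K : numClosedFieldType.
Implicit Types (F G : {mpoly K[3]}) (P : 'rV[K]_3) (M N : 'M[K]_3).

(** The transition matrix from the first chart to the second one; both send
    the origin to P, but possibly with different scalars. *)
Lemma charts_related P M M' : moves_to_origin P M ->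
  moves_to_origin P M' -> exists2 b, fixes_origin (M' *m invmx M) b &
  forall F, change_coords M' F =
    change_coords (M' *m invmx M) (change_coords M F).
Proof.
move=> [uM [c eM]] [uM' [c' eM']].
have nz N x : N \in unitmx -> origin K *m N = x *: P -> x != 0.
  move=> uN e; apply/eqP => x0; move: e; rewrite x0 scale0r.
  move/(congr1 (mulmx^~ (invmx N))); rewrite mul0mx mulmxK //.
  move/matrixP/(_ 0 ord_max)/eqP; rewrite !mxE !eqxx /=.
  by rewrite oner_eq0.
exists (c' / c) => [|F]; last by rewrite change_coordsM mulmxKV.
split; first by rewrite unitmx_mul uM' unitmx_inv.
  by rewrite mulf_neq0 ?invr_eq0 ?(nz _ _ uM eM) ?(nz _ _ uM' eM').
rewrite mulmxA eM'; have -> : P = c^-1 *: (origin K *m M).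
  by rewrite eM scalerA mulVf ?scale1r // (nz _ _ uM eM).
by rewrite scalerA -scalemxAl mulmxK.
Qed.

Lemma has_mult2_chart F P M M' d : F \is d.-homog ->
  moves_to_origin P M -> moves_to_origin P M' ->
  has_mult (dehomog (change_coords M F)) 2 ->
  has_mult (dehomog (change_coords M' F)) 2.
Proof.
move=> homF mM mM'; have [b fC ->] := charts_related mM mM'.
exact: has_mult2_change_coords (change_coords_homog M homF) fC.
Qed.

(** Order 2 is separate: it holds at every double point, whereas the
    transport of an osculating curve needs order 3. *)
Lemma osculates_chart F P M M' d m : F \is d.-homog -> (1 < m)%N ->
  moves_to_origin P M -> moves_to_origin P M' ->
  double_in_y (dehomog (change_coords M' F)) ->
  osculates (dehomog (change_coords M F)) m ->
  osculates (dehomog (change_coords M' F)) m.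
Proof.
move=> homF m1 mM mM' gM'; case: (ltngtP m 2) => [|m3|->].
- move=> m2; exfalso; move: m1; rewrite ltnNge -ltnS m2.
  exact/negP.
- have [b fC eC] := charts_related mM mM'; move: gM' => [_]; rewrite eC => a02.
  exact: osculates_change_coords (change_coords_homog M homF) fC m3 a02.
- by move=> _; apply: osculates2_double.
Qed.

Lemma moves_to_origin_mul P M N c : moves_to_origin P M -> N \in unitmx ->
  origin K *m N = c *: origin K -> moves_to_origin P (N *m M).
Proof.
move=> [uM [b eM]] uN eN; split; first by rewrite unitmx_mul uN.
by exists (c * b); rewrite mulmxA eN -scalemxAl eM scalerA.
Qed.

Lemma double_testP (f : {poly {poly K}}) : acoef f 0 0 = 0 ->
  double_test f <-> has_mult f 2.
Proof.
move=> f00; rewrite /double_test !xpair_eqE; split.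
  move=> /andP [/andP [/eqP f01 /eqP f10] nz]; split.
    by move=> [|[|i]] [|[|j]].
  move: nz; rewrite !negb_and => /orP[/orP[]|] nz;
    by [exists 2%N, 0%N|exists 1%N, 1%N|exists 0%N, 2%N].
move=> f2; have [_ -> ->] := mult2_low f2; rewrite eqxx /=.
case: f2 => _ [[|[|[|i]]] [[|[|[|j]]] [//= _]]] nz;
  by rewrite (negbTE nz) ?andbF.
Qed.

(** Both directions pass through the chart N M in which the algorithm runs.
    From a resolution in an arbitrary chart M', an adapted chart gives the
    maximal order of osculation, which is transported to N M in both ways: once
    for existence and once for maximality. *)
Lemma algorithm_correct F P d M N r two : F \is d.-homog ->
  on_curve F P -> admissible F P M N -> (0 < r)%N ->
  run F M N (stop r two) <->
  exists M', [/\ moves_to_origin P M', has_mult (dehomog (change_coords M' F)) 2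
    & resolution (dehomog (change_coords M' F)) r (1 + two)].
Proof.
move=> homF FP [mM admN] r0.
have f00 : acoef (dehomog (change_coords M F)) 0 0 = 0.
  have [uM [c eM]] := mM.
  rewrite acoef_dehomog00 /at_origin (mmap_change_coords idfun).
  rewrite (@eq_mmap _ _ _ idfun _ (fun i => c * P 0 i)) => [|i].
    by rewrite (mmap_homog _ _ _ homF) -/(meval _ _) FP mulr0.
  rewrite sum3 /= !mulr0 !add0r mulr1.
  have := congr1 (fun y : 'rV_3 => y 0 i) eM; rewrite /origin -rowE !mxE => <-.
  by congr (M _ i); apply: val_inj.
have NM_chart : has_mult (dehomog (change_coords M F)) 2 ->
    moves_to_origin P (N *m M) /\ double_in_y (dehomog (change_coords (N *m M) F)).
  move=> f2; have [[uN [c eN]] a02] := admN ((double_testP f00).2 f2).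
  have mNM := moves_to_origin_mul mM uN eN.
  split; first exact: mNM.
  split; first exact: has_mult2_chart homF mM mNM f2.
  rewrite -change_coordsM; exact: a02.
split=> [run|[M' [mM' f2' res]]].
  have [dt run'] : double_test (dehomog (change_coords M F)) /\
      run_step (dehomog (change_coords N (change_coords M F))) [::] (stop r two).
    by move def_o: (stop r two) run => o run; case: run def_o => //; case: two.
  have [mNM gNM] := NM_chart ((double_testP f00).1 dt).
  exists (N *m M); split; [exact: mNM|exact: gNM.1|].
  apply: (run_resolution gNM); rewrite -change_coordsM; exact: run'.
have f2 := has_mult2_chart homF mM' mM f2'; have [mNM gNM] := NM_chart f2.
apply: run_double; first exact/double_testP.
rewrite change_coordsM.
have [C [two' [fC a02] [two_eq osc nosc]]] :=
  adapted_chart (change_coords_homog M' homF) f2' res.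
have -> : two = two' by move: two_eq; clear; case: two; case: two'.
have [uC _ eC] := fC; have mC := moves_to_origin_mul mM' uC eC.
have gC : double_in_y (dehomog (change_coords (C *m M') F)).
  split; first exact: has_mult2_chart homF mM' mC f2'.
  rewrite -change_coordsM; exact: a02.
rewrite change_coordsM in osc nosc.
case: r r0 res osc nosc => // r _ _ osc nosc; apply: (osculates_run gNM).
  by apply: (osculates_chart homF _ mC mNM gNM osc).
move=> osc'; apply: nosc; by apply: (osculates_chart homF _ mNM mC gC osc').
Qed.

End Main.

Theorem proposition3p3 (R : realType) (n : nat) (F : {mpoly R[i][3]})
    (P : 'rV[R[i]]_3) :
  (0 < n)%N -> F \is n.-homog -> reduced F ->
  P != 0 -> on_curve F P ->
  forall M N : 'M[R[i]]_3, admissible F P M N ->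
  forall r : nat, (1 <= r)%N ->
    (run F M N (StopA r) <-> is_type_A (2 * r - 1) F P) /\
    (run F M N (StopB r) <-> is_type_A (2 * r) F P).
Proof.
move=> _ homF _ _ FP M N adm r r0.
have type_A (two : bool) s : (s + two = 2 * r)%N -> (exists M',
    [/\ moves_to_origin P M', has_mult (dehomog (change_coords M' F)) 2
    & resolution (dehomog (change_coords M' F)) r (1 + two)]) <-> is_type_A s F P.
  move=> s_eq; split=> [[M' [mM' f2 res]]|[M' [mM' [f2 [r' [two' [s_eq' res]]]]]]].
    by exists M'; split=> //; split=> //; exists r, two.
  exists M'; split=> //; have [<- <-] : r' = r /\ two' = two; last by [].
  by move: s_eq s_eq'; case: two; case: two' {res} => /= s_eq s_eq'; split=> //; lia.
split.
  apply: (iff_trans (algorithm_correct true homF FP adm r0)); apply: type_A.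
  by rewrite subnK // muln_gt0.
apply: (iff_trans (algorithm_correct false homF FP adm r0)); apply: type_A.
by rewrite addn0.
Qed.
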